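(* For the Gaussian state-dependent multiaccess channel described in the context, for $\rho\in[-1,0]$ let $\tilde Q(\rho)=(\sqrt Q+\rho\sqrt{P_2})^2$. The capacity region $\mathcal C_G$ contains the union, over all $\theta\in[0,1]$ (with $\bar\theta=1-\theta$), $\xi\in[0,1]$, $\rho\in[-\sqrt{1-\xi},0]$, and $\alpha\in\mathbb R$ such that all logarithm terms below are non-negative real numbers, of the set of rate pairs $(R_c,R_1)$ satisfying $$R_1<\tfrac12\log\Big(1+\frac{\theta P_1}{N+\frac{P_2\xi\tilde Q(\rho)(1-\alpha)^2}{P_2\xi+\alpha^2\tilde Q(\rho)}}\Big),$$ $$R_1<\tfrac12\log\Big(\frac{P_2\xi\,(P_2\xi+\tilde Q(\rho)+N+\theta P_1)}{P_2\xi\tilde Q(\rho)(1-\alpha)^2+N(P_2\xi+\alpha^2\tilde Q(\rho))}\Big),$$ $$R_c+R_1<\tfrac12\log\Big(1+\frac{(\sqrt{\bar\theta P_1}+\sqrt{1-\xi-\rho^2}\sqrt{P_2})^2+\theta P_1}{P_2\xi+\tilde Q(\rho)+N}\Big)+\tfrac12\log\Big(\frac{P_2\xi\,(P_2\xi+\tilde Q(\rho)+N)}{P_2\xi\tilde Q(\rho)(1-\alpha)^2+N(P_2\xi+\alpha^2\tilde Q(\rho))}\Big).$$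
   Context: Gaussian model: at each time $i$, $Y_i=X_{1,i}+X_{2,i}+S_i+Z_i$, where $S_i\sim\mathcal N(0,Q)$ (state) and $Z_i\sim\mathcal N(0,N)$ (noise), all $S_i,Z_i$ mutually independent across time and of each other, and independent of the messages; $Q,N>0$. Two independent uniformly distributed messages: a common message $W_c$ of rate $R_c$ and an individual message $W_1$ of rate $R_1$. The uninformed encoder maps $(W_c,W_1)$ to $X_1^n$; the informed encoder knows the entire state sequence $S^n$ non-causally and maps $(S^n,W_c)$ to $X_2^n$; the decoder, which does not know the state, maps $Y^n$ to an estimate of $(W_c,W_1)$. Power constraints: $\sum_{i=1}^n X_{1,i}^2\le nP_1$ and $\sum_{i=1}^n X_{2,i}^2\le nP_2$. A rate pair is achievable if there are codes satisfying these constraints whose probability of decoding error $\Pr[\psi^n(Y^n)\neq (W_c,W_1)]$ tends to $0$ as $n\to\infty$; $\mathcal C_G$ is the closure of the set of achievable pairs. *)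

(* Defs.v *)
From HB Require Import structures.
From mathcomp Require Import all_boot all_order all_algebra.
From mathcomp Require Import all_classical all_reals all_analysis.
Set Implicit Arguments. Unset Strict Implicit. Unset Printing Implicit Defensive.
Import Order.TTheory GRing.Theory Num.Theory.
Import numFieldNormedType.Exports.
Local Open Scope classical_set_scope.
Local Open Scope ring_scope.

Section GaussMAC.
Context {R : realType} {d : measure_display} {T : measurableType d}
  (P : probability T R).

(* The i.i.d. state sequence S_i ~ N(0,Q), noise sequence Z_i ~ N(0,N),
   all mutually independent.  normal_prob takes the standard deviation. *)
Definition gauss_state_noise (Q N : R) (S Z : nat -> {RV P >-> R}) : Prop :=
  (forall i (B : set R), measurable B ->
      P (S i @^-1` B) = normal_prob 0 (Num.sqrt Q) B) /\
  (forall i (B : set R), measurable B ->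
      P (Z i @^-1` B) = normal_prob 0 (Num.sqrt N) B) /\
  (forall (m : nat) (B B' : nat -> set R),
      (forall i, measurable (B i)) -> (forall i, measurable (B' i)) ->
      P (\bigcap_(i in `I_m) (S i @^-1` B i `&` Z i @^-1` B' i)) =
      (\prod_(i < m) (P (S i @^-1` B i) * P (Z i @^-1` B' i)))%E).

Record code (n Mc M1 : nat) := Code {
  enc1 : 'I_Mc -> 'I_M1 -> 'I_n -> R;
  enc2 : 'I_Mc -> ('I_n -> R) -> 'I_n -> R;    (* informed encoder (sees S^n) *)
  dec  : ('I_n -> R) -> 'I_Mc * 'I_M1 }.

Definition power_ok (P1 P2 : R) n Mc M1 (c : code n Mc M1) : Prop :=
  (forall wc w1, \sum_(i < n) (enc1 c wc w1 i) ^+ 2 <= n%:R * P1) /\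
  (forall wc (s : 'I_n -> R), \sum_(i < n) (enc2 c wc s i) ^+ 2 <= n%:R * P2).

Definition err_event (S Z : nat -> {RV P >-> R}) n Mc M1 (c : code n Mc M1)
  (wc : 'I_Mc) (w1 : 'I_M1) : set T :=
  [set t | dec c (fun i : 'I_n =>
      enc1 c wc w1 i + enc2 c wc (fun j : 'I_n => S j t) i + S i t + Z i t)
      != (wc, w1)].

Definition err_prob (S Z : nat -> {RV P >-> R}) n Mc M1 (c : code n Mc M1) : R :=
  ((Mc * M1)%:R)^-1 *
  \sum_(wc < Mc) \sum_(w1 < M1) fine (P (err_event S Z c wc w1)).

(* Rates in nats: at least exp(n R) messages. *)
Definition achievable (P1 P2 : R) (S Z : nat -> {RV P >-> R}) (Rc R1 : R) : Prop :=
  exists (Mc M1 : nat -> nat) (c : forall n, code n (Mc n) (M1 n)),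
    (forall n, expR (n%:R * Rc) <= (Mc n)%:R /\ expR (n%:R * R1) <= (M1 n)%:R) /\
    (forall n, power_ok P1 P2 (c n)) /\
    (forall n wc w1, measurable (err_event S Z (c n) wc w1)) /\
    (fun n => err_prob S Z (c n)) @ \oo --> (0 : R).

Definition capacity_region (P1 P2 : R) (S Z : nat -> {RV P >-> R}) : set (R * R) :=
  closure [set p : R * R | achievable P1 P2 S Z p.1 p.2].

End GaussMAC.

Definition Qt {R : realType} (Q P2 rho : R) : R :=
  (Num.sqrt Q + rho * Num.sqrt P2) ^+ 2.

Definition inner_region {R : realType} (P1 P2 Q N : R) : set (R * R) :=
  [set p : R * R | exists th xi rho alpha : R,
    let q := Qt Q P2 rho in
    let D1 := P2 * xi + alpha ^+ 2 * q in
    let D2 := P2 * xi * q * (1 - alpha) ^+ 2 + N * (P2 * xi + alpha ^+ 2 * q) in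
    let D3 := P2 * xi + q + N in
    let E1 := N + P2 * xi * q * (1 - alpha) ^+ 2 / D1 in
    let A1 := 1 + th * P1 / E1 in
    let A2 := P2 * xi * (P2 * xi + q + N + th * P1) / D2 in
    let A3 := 1 + ((Num.sqrt ((1 - th) * P1)
                    + Num.sqrt (1 - xi - rho ^+ 2) * Num.sqrt P2) ^+ 2
                   + th * P1) / D3 in
    let A4 := P2 * xi * (P2 * xi + q + N) / D2 in
    [/\ 0 <= th <= 1, 0 <= xi <= 1, - Num.sqrt (1 - xi) <= rho <= 0 &
    [/\ D1 != 0, E1 != 0, D2 != 0, D3 != 0 &
    [/\ 1 <= A1, 1 <= A2, 1 <= A3, 1 <= A4 &
    [/\ 0 <= p.1, 0 <= p.2,
        p.2 < ln A1 / 2, p.2 < ln A2 / 2 &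
        p.1 + p.2 < ln A3 / 2 + ln A4 / 2]]]]].

(* Main.v *)
Require Import Defs.
From HB Require Import structures.
From mathcomp Require Import all_boot all_order all_algebra.
From mathcomp Require Import all_classical all_reals all_analysis.
From mathcomp Require Import measurable_realfun ring lra.
Set Implicit Arguments. Unset Strict Implicit. Unset Printing Implicit Defensive.
Import Order.TTheory GRing.Theory Num.Theory.
Import numFieldNormedType.Exports.
Local Open Scope classical_set_scope.
Local Open Scope ring_scope.

(**
  Dirty-paper coding over a random Gaussian codebook. The common message [c]
  owns a codeword [V_c] and a bin of auxiliary codewords [U_cl], the pair
  [(c, w)] a codeword [X_cw]. The uninformed encoder sends [a V + b X]; the
  informed one picks an index [l], with probability proportional to the
  likelihood ratio of [U_cl] given the state [S], and sends
  [cc V + r S + (U_cl - al k S)] with [k = 1 + r]. The decoder outputs the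
  message pair carrying more than half of the total Gaussian likelihood
  weight. The probability that a soft encoder and a soft decoder both pick the
  right index is at least [w/L * (3 - p - q)] where [p] and [q] are linear in
  the weights of the competing codewords (AM-GM), so averaging over the
  codebook only requires integrating out competing Gaussian codewords one at a
  time. What is left is the probability, under the law in which
  [U = al k S + G] with [G] independent of [S], that eight quadratic forms of
  independent Gaussians are far from their means; Chernoff's bound makes it
  exponentially small. Finally the decoder's rule loses a factor two against
  the soft decoder, the informed encoder is derandomized by taking the index
  of least conditional error probability, and shrinking all amplitudes by a
  factor less than one makes room for the power constraints.
*)

(** * Finite product probability spaces *)

(** The obstacle is the informed encoder: once it selects an index of its bin from the state, the
    transmitted codeword depends on the whole bin, and conditioning on the selection destroys the
    independence of the codewords. Selection by likelihood ratio keeps this dependence explicit, as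
    one weight divided by the total weight of the bin, and the soft decoder contributes a second
    quotient of the same kind. The two normalized totals [p] and [q] both have mean close to one,
    which is the equality case of AM-GM, so replacing 1/(pq) by its linear lower bound loses nothing
    to first order. The mean of [p] is close to one when the bin is larger than exp(n I(U;S)), which
    is covering; that of [q] when there are few enough wrong codewords, which is packing. A wrong
    codeword differs in X only, in X and U, or in X, U and V. These three cases give the three rate
    bounds, and the bin size is what subtracts I(U;S) from the last two. *)

Section product_space.
Context {I : finType} {d : measure_display} {T : measurableType d}.

Definition rect (B : I -> set T) : set (I -> T) := [set x | forall i, B i (x i)].

Definition rects : set (set (I -> T)) :=
  [set A | exists2 B : I -> set T, (forall i, measurable (B i)) & A = rect B].

Definition update (x : I -> T) (j : I) (a : T) : I -> T :=
  fun i => if i == j then a else x i.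

Lemma update_same x j a : update x j a j = a.
Proof. by rewrite /update eqxx. Qed.

Lemma update_neq x j a i : i != j -> update x j a i = x i.
Proof. by rewrite /update => /negbTE ->. Qed.

End product_space.
Arguments rects : clear implicits.

Notation pspace I T := (g_sigma_algebraType (rects I _ T)).

Section product_space_measurability.
Context {I : finType} {d : measure_display} {T : measurableType d}.

Lemma measurable_rect (B : I -> set T) : (forall i, measurable (B i)) ->
  measurable (rect B : set (pspace I T)).
Proof. by move=> mB; apply: sub_sigma_algebra; exists B. Qed.

Lemma measurable_coord (i : I) : measurable_fun setT (fun x : pspace I T => x i).
Proof.
move=> _ B mB; rewrite setTI.
rewrite [X in measurable X](_ : _ =
    rect (fun k => if k == i then B else setT)); last first.
  apply/seteqP; split => x /=.
    by move=> Bx k; case: eqP => // ->.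
  by move=> /(_ i); rewrite eqxx.
by apply: measurable_rect => k; case: ifP.
Qed.

Lemma measurable_coord_comp (d' : measure_display) (U : measurableType d')
    (f : U -> pspace I T) (i : I) :
  measurable_fun setT f -> measurable_fun setT (fun u => f u i).
Proof.
by move=> mf; apply: (@measurableT_comp _ _ _ _ _ _ (fun x : pspace I T => x i));
  [exact: measurable_coord|exact: mf].
Qed.

Lemma measurable_pspace (d' : measure_display) (U : measurableType d')
    (f : U -> pspace I T) :
  (forall i, measurable_fun setT (fun u => f u i)) -> measurable_fun setT f.
Proof.
move=> mf; apply: (@measurability _ _ _ _ setT f (rects I _ T)) => //.
move=> _ [_ [B mB ->] <-]; rewrite setTI.
rewrite [X in measurable X](_ : _ =
    \bigcap_(i in [set: I]) ((fun u => f u i) @^-1` B i)); last first.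
  by apply/seteqP; split => x /= xB; [move=> i _; exact: xB|
    move=> i; exact: xB].
apply: fin_bigcap_measurable => // i _.
by rewrite -[X in measurable X]setTI; exact: mf.
Qed.

Definition update_right (j : I) (p : pspace I T * T) : pspace I T :=
  update p.1 j p.2.

Definition update_left (j : I) (p : T * pspace I T) : pspace I T :=
  update p.2 j p.1.

Lemma measurable_update_right (j : I) : measurable_fun setT (update_right j).
Proof.
apply: measurable_pspace => i; rewrite /update_right /update; case: eqP => _.
  exact: measurable_snd.
by apply: (@measurable_coord_comp _ _ fst); exact: measurable_fst.
Qed.

Lemma measurable_update_left (j : I) : measurable_fun setT (update_left j).
Proof.
apply: measurable_pspace => i; rewrite /update_left /update; case: eqP => _.
  exact: measurable_fst.
by apply: (@measurable_coord_comp _ _ snd); exact: measurable_snd.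
Qed.

HB.instance Definition _ j := 
  isMeasurableFun.Build _ _ _ _ _ (measurable_update_right j).

HB.instance Definition _ j :=
  isMeasurableFun.Build _ _ _ _ _ (measurable_update_left j).

Lemma rectsI : setI_closed (rects I _ T).
Proof.
move=> _ _ [A mA ->] [B mB ->]; exists (fun i => A i `&` B i).
  by move=> i; exact: measurableI.
apply/seteqP; split => x /=.
  by move=> [xA xB] i; split.
by move=> xAB; split=> i; case: (xAB i).
Qed.

Lemma pspace_measure_unique (R : realType) (m1 m2 : probability (pspace I T) R) :
  (forall B, (forall i, measurable (B i)) -> m1 (rect B) = m2 (rect B)) ->
  forall A, measurable A -> m1 A = m2 A.
Proof.
move=> m12 A mA; apply: (@measure_unique _ R (pspace I T) (rects I _ T) (fun=> setT)) => //.
- exact: rectsI.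
- move=> _; exists (fun=> setT) => //.
  by apply/seteqP; split.
- by rewrite bigcup_const.
- by move=> _ [B mB ->]; exact: m12.
- by move=> _; rewrite -ge0_fin_numE// fin_num_measure.
Qed.

End product_space_measurability.

Section product_probability.
Local Open Scope ereal_scope.
Context {R : realType} {I : finType} {d : measure_display} {T : measurableType d}.
Variable mu : I -> probability T R.

(** Coordinates outside [l] are frozen at [point]; only the full enumeration used in [pprob] gives
    every coordinate its own law. *)
Fixpoint pprob_seq (l : seq I) : probability (pspace I T) R :=
  if l is k :: l' then
    distribution (mu k \x pprob_seq l') (update_left k)
  else dirac point.

Definition pprob := pprob_seq (index_enum I).

Lemma pprob_seq_rect (l : seq I) (B : I -> set T) : uniq l ->
  (forall i, measurable (B i)) -> (forall i, i \notin l -> B i = setT) ->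
  pprob_seq l (rect B) = \prod_(i <- l) mu i (B i).
Proof.
elim: l B => [|k l IH] B /=.
  move=> _ mB BT; rewrite big_nil (_ : rect B = setT) ?diracT//.
  by apply/seteqP; split => // x _ i; rewrite BT.
move=> /andP[kl ul] mB BT; rewrite big_cons.
rewrite /distribution /pushforward /=.
pose B' i := if i == k then setT else B i.
rewrite [X in product_measure1 _ _ X](_ : _ = B k `*` rect B'); last first.
  apply/seteqP; split => -[a x] /=.
    move=> h; split; first by have := h k; rewrite /update_left update_same.
    move=> i; rewrite /B'; case: eqVneq => // ik.
    by have := h i; rewrite /update_left update_neq.
  move=> [Ba h] i; rewrite /update_left /update; case: eqP => [->//|/eqP ik].
  by have := h i; rewrite /B' (negbTE ik).
have mB' i : measurable (B' i) by rewrite /B'; case: ifP.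
rewrite product_measure1E//=; last exact: measurable_rect.
congr (_ * _); rewrite IH//; last first.
  move=> i il; rewrite /B'; case: eqVneq => // ik; apply: BT.
  by rewrite inE negb_or ik.
apply: eq_big_seq => i il; rewrite /B'; case: eqVneq => // ik.
by move: kl; rewrite -ik il.
Qed.

Lemma pprob_rect (B : I -> set T) : (forall i, measurable (B i)) ->
  pprob (rect B) = \prod_i mu i (B i).
Proof.
move=> mB; rewrite /pprob pprob_seq_rect ?index_enum_uniq// => i.
by rewrite mem_index_enum.
Qed.

(** Resampling one coordinate independently preserves the law, since both laws agree on rectangles.
    This is how a single codeword is integrated while all others stay fixed. *)
Lemma ge0_integral_pprob_update (j : I) (F : pspace I T -> \bar R) :
  measurable_fun [set: pspace I T] F -> (forall x, 0 <= F x) ->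
  \int[pprob]_x F x = \int[pprob]_x \int[mu j]_a F (update x j a).
Proof.
move=> mF F0.
pose m2 := distribution (pprob \x mu j) (update_right j).
rewrite (eq_measure_integral m2); last first.
  move=> A mA _; apply: pspace_measure_unique mA => B mB.
  rewrite pprob_rect// /m2 /= /distribution /pushforward /=.
  pose B' i := if i == j then setT else B i.
  rewrite [X in product_measure1 _ _ X](_ : _ = rect B' `*` B j); last first.
    apply/seteqP; split => -[x a] /=.
      move=> h; split; last by have := h j; rewrite /update_right update_same.
      move=> i; rewrite /B'; case: eqVneq => // ij.
      by have := h i; rewrite /update_right update_neq.
    move=> [h Ba] i; rewrite /update_right /update; case: eqP => [->//|/eqP ik].
    by have := h i; rewrite /B' (negbTE ik).
  have mB' i : measurable (B' i) by rewrite /B'; case: ifP.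
  rewrite product_measure1E//=; last exact: measurable_rect.
  rewrite -/pprob pprob_rect// (bigD1 j)//= [in RHS](bigD1 j)//=.
  rewrite {1}/B' eqxx probability_setT mul1e muleC; congr (_ * _).
  by apply: eq_bigr => i /negbTE ij; rewrite /B' ij.
rewrite /m2 ge0_integral_distribution// fubini_tonelli1//.
by apply: measurableT_comp => //; exact: measurable_update_right.
by move=> p; exact: F0.
Qed.

Lemma ge0_integral_pprob_prod (f : I -> T -> R) :
  (forall i, measurable_fun setT (f i)) -> (forall i a, (0 <= f i a)%R) ->
  \int[pprob]_x (\prod_i f i (x i))%:E = \prod_i \int[mu i]_a (f i a)%:E.
Proof.
move=> mf f0; rewrite /pprob.
have mprod (l : seq I) :
    measurable_fun setT (fun x : pspace I T => (\prod_(i <- l) f i (x i))%R).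
  by apply: measurable_prod => i _; exact: measurableT_comp (measurable_coord i).
suff H (l : seq I) : uniq l -> \int[pprob_seq l]_x (\prod_(i <- l) f i (x i))%:E =
    \prod_(i <- l) \int[mu i]_a (f i a)%:E.
  exact: H (index_enum_uniq _).
elim: l => [_|k l IH /= /andP[kl ul]].
  under eq_integral do rewrite big_nil.
  by rewrite big_nil integral_cst//= mul1e probability_setT.
rewrite ge0_integral_distribution//=; last 2 first.
- by apply/measurable_EFinP; exact: mprod.
- by move=> x; rewrite lee_fin prodr_ge0.
rewrite fubini_tonelli1//=; last 2 first.
- apply: measurableT_comp => //.
  by apply: measurableT_comp (mprod _) _; exact: measurable_update_left.
- by move=> x; rewrite lee_fin prodr_ge0.
rewrite big_cons -IH// /fubini_F -ge0_integralZr//; last 3 first.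
- exact/measurable_EFinP.
- by move=> a _; rewrite lee_fin.
- by apply: integral_ge0 => x _; rewrite lee_fin prodr_ge0.
apply: eq_integral => a _ /=.
rewrite -ge0_integralZl//=; last 3 first.
- by apply/measurable_EFinP; exact: mprod.
- by move=> x _; rewrite lee_fin prodr_ge0.
- by rewrite lee_fin.
apply: eq_integral => x _ /=.
rewrite /update_left big_cons update_same EFinM; congr (_ * _%:E).
apply: eq_big_seq => i il; rewrite update_neq//.
by apply: contraNneq kl => <-.
Qed.

End product_probability.

(** * Gaussian integrals *)

Section gaussian_integrals.
Context {R : realType}.

Lemma ge0_integral_normal_prob (m s : R) (f : R -> \bar R) :
  measurable_fun setT f -> (forall x, 0 <= f x)%E ->
  (\int[normal_prob m s]_x f x =
   \int[lebesgue_measure]_x (f x * (normal_pdf m s x)%:E))%E.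
Proof.
move=> mf f0.
have dom := normal_prob_dominates m s.
have mpdf : measurable_fun setT (fun x => (normal_pdf m s x)%:E).
  by apply/measurable_EFinP; exact: measurable_normal_pdf.
rewrite -(Radon_Nikodym_SigmaFinite.change_of_variables dom)//=.
apply: ge0_ae_eq_integral => //.
- apply: emeasurable_funM => //.
  apply: (measurable_int lebesgue_measure).
  exact: Radon_Nikodym_SigmaFinite.f_integrable.
- exact: emeasurable_funM.
- by move=> x _; rewrite mule_ge0//; exact: Radon_Nikodym_SigmaFinite.f_ge0.
- by move=> x _; rewrite mule_ge0// lee_fin normal_pdf_ge0.
(* The Radon-Nikodym derivative and [normal_pdf] have equal integrals over every measurable set,
   hence agree almost everywhere. *)
apply: ae_eqe_mul2l; apply: integral_ae_eq => //=.
- exact: Radon_Nikodym_SigmaFinite.f_integrable.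
- move=> E _ mE; rewrite -Radon_Nikodym_SigmaFinite.f_integral//.
Qed.

Lemma sqrt_expR_ln (x : R) : 0 < x -> (Num.sqrt x)^-1 = expR (- (ln x / 2)).
Proof.
move=> x0; rewrite expRN; congr (_^-1).
rewrite -[in LHS](lnK x0) [in LHS](_ : ln x = ln x / 2 + ln x / 2); last lra.
by rewrite expRD -expr2 sqrtr_sqr ger0_norm// expR_ge0.
Qed.

Lemma measurable_expR_sqr (h b y : R) :
  measurable_fun setT (fun x : R => expR (- (h * (y + b * x) ^+ 2))).
Proof.
apply: measurableT_comp => //; apply: measurableT_comp => //.
apply: measurable_funM; first exact: measurable_cst.
apply: measurable_funX; apply: measurable_funD; first exact: measurable_cst.
by apply: measurable_funM; [exact: measurable_cst|exact: measurable_id].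
Qed.

(* Completing the square: the integrand times the density is again a normal
   density, of mean [m'] and variance [s ^+ 2 / D], up to a constant. *)
Lemma integral_normal_expR_sqr (m s h b y : R) : s != 0 ->
  let D := 1 + 2 * h * b ^+ 2 * s ^+ 2 in 0 < D ->
  (\int[normal_prob m s]_x (expR (- (h * (y + b * x) ^+ 2)))%:E =
   (expR (- (ln D / 2) - h / D * (y + b * m) ^+ 2))%:E)%E.
Proof.
move=> s0 D; have DE : D = 1 + 2 * h * b ^+ 2 * s ^+ 2 by [].
clearbody D => D0.
have DN0 : D != 0 by rewrite gt_eqF.
rewrite ge0_integral_normal_prob//=; last first.
  by apply/measurable_EFinP; exact: measurable_expR_sqr.
pose s' := s / Num.sqrt D; pose m' := (m - 2 * h * b * s ^+ 2 * y) / D.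
have sD0 : Num.sqrt D != 0 by rewrite gt_eqF// sqrtr_gt0.
have s'0 : s' != 0 by rewrite /s' mulf_neq0// invr_eq0.
have s'2 : s' ^+ 2 = s ^+ 2 / D.
  by rewrite /s' exprMn exprVn sqr_sqrtr// ltW.
pose C := expR (- (ln D / 2) - h / D * (y + b * m) ^+ 2).
transitivity (\int[lebesgue_measure]_x (C%:E * (normal_pdf m' s' x)%:E))%E.
  apply: eq_integral => x _; rewrite -!EFinM; congr EFin.
  rewrite !normal_pdfE// /normal_peak /normal_fun s'2 /C.
  rewrite expRD -sqrt_expR_ln//.
  have -> : s ^+ 2 / D * pi *+ 2 = D^-1 * (s ^+ 2 * pi *+ 2).
    by rewrite -mulrnAr -[in RHS]mulrnAr; move: (pi *+ 2) => p; rewrite mulrA (mulrC _^-1).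
  rewrite (sqrtrM (s ^+ 2 * pi *+ 2)); last by rewrite invr_ge0 ltW.
  rewrite sqrtrV; last exact: ltW.
  rewrite invfM invrK.
  set k := (Num.sqrt (s ^+ 2 * pi *+ 2))^-1.
  transitivity (k * expR (- (h / D * (y + b * m) ^+ 2) +
      - (x - m') ^+ 2 / (s ^+ 2 / D *+ 2))); last first.
    rewrite expRD; move: (expR _) (expR _) => e1 e2.
    by rewrite [RHS]mulrACA mulKf.
  rewrite mulrCA -expRD; congr (_ * expR _).
  rewrite /m'; move: DN0; rewrite DE => DN0; field.
  by apply/andP; split.
rewrite integralZl//; last exact: integrable_normal_pdf.
by rewrite integral_normal_pdf mule1.
Qed.

(* Reweighting by the likelihood ratio moves the mean of the codeword onto a
   multiple of the state. *)
Definition tilt (su sg M u : R) : R := normal_pdf M sg u / normal_pdf 0 su u.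

Lemma tilt_ge0 su sg M u : 0 <= tilt su sg M u.
Proof. by rewrite divr_ge0 ?normal_pdf_ge0. Qed.

Lemma tiltE su sg M u : 0 < su -> 0 < sg -> tilt su sg M u =
  expR (ln (su ^+ 2 / sg ^+ 2) / 2 +
    (u ^+ 2 / su ^+ 2 / 2 - (u - M) ^+ 2 / sg ^+ 2 / 2)).
Proof.
move=> su0 sg0; rewrite /tilt !normal_pdfE ?gt_eqF//.
rewrite /normal_peak /normal_fun subr0.
have spi (s : R) : 0 < s -> Num.sqrt (s ^+ 2 * pi *+ 2) = s * Num.sqrt (pi *+ 2).
  by move=> s0; rewrite -mulrnAr sqrtrM ?sqr_ge0// sqrtr_sqr gtr0_norm.
rewrite !spi//.
have k0 : Num.sqrt (pi *+ 2 : R) != 0.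
  by rewrite gt_eqF// sqrtr_gt0 pmulrn_lgt0// pi_gt0.
have -> : ln (su ^+ 2 / sg ^+ 2) / 2 = ln (su / sg).
  by rewrite -exprVn -exprMn lnXn ?divr_gt0//; field.
rewrite !expRD lnK ?posrE ?divr_gt0// expRN.
rewrite (_ : u ^+ 2 / su ^+ 2 / 2 = - (- u ^+ 2 / (su ^+ 2 *+ 2))); last first.
  by field; rewrite gt_eqF.
rewrite (_ : (u - M) ^+ 2 / sg ^+ 2 / 2 = - (- (u - M) ^+ 2 / (sg ^+ 2 *+ 2))); last first.
  by field; rewrite gt_eqF.
rewrite !expRN invrK.
have e0 : expR (- u ^+ 2 / (su ^+ 2 *+ 2)) != 0 by rewrite gt_eqF// expR_gt0.
move: e0; set E1 := expR _ => e0.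
by set E2 := expR _; field; rewrite e0 k0 !gt_eqF.
Qed.

Lemma measurable_tilt su sg M : 0 < su -> 0 < sg ->
  measurable_fun setT (tilt su sg M).
Proof.
move=> su0 sg0.
rewrite (_ : tilt su sg M = fun u => expR (ln (su ^+ 2 / sg ^+ 2) / 2 +
    (u ^+ 2 / su ^+ 2 / 2 - (u - M) ^+ 2 / sg ^+ 2 / 2))); last first.
  by apply/funext => u; rewrite tiltE.
apply: measurableT_comp => //; apply: measurable_funD => //.
apply: measurable_funB.
  by apply: measurable_funM => //; apply: measurable_funM => //; exact: measurable_funX.
apply: measurable_funM => //; apply: measurable_funM => //.
by apply: measurable_funX; exact: measurable_funB.
Qed.

Lemma integral_tilt su sg M (f : R -> R) : 0 < su -> 0 < sg ->
  measurable_fun setT f -> (forall x, 0 <= f x) ->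
  (\int[normal_prob 0 su]_u (tilt su sg M u * f u)%:E =
   \int[normal_prob M sg]_u (f u)%:E)%E.
Proof.
move=> su0 sg0 mf f0.
have mtf : measurable_fun setT (fun u => (tilt su sg M u * f u)%:E).
  by apply/measurable_EFinP; apply: measurable_funM mf; exact: measurable_tilt.
have tf0 u : (0 <= (tilt su sg M u * f u)%:E)%E.
  by rewrite lee_fin mulr_ge0// tilt_ge0.
have mEf : measurable_fun setT (fun u => (f u)%:E) by exact/measurable_EFinP.
have Ef0 u : (0 <= (f u)%:E)%E by rewrite lee_fin.
rewrite (ge0_integral_normal_prob 0 su mtf tf0) (ge0_integral_normal_prob M sg mEf Ef0).
apply: eq_integral => u _; rewrite -!EFinM; congr EFin.
rewrite /tilt mulrAC divfK; first by rewrite mulrC.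
rewrite normal_pdfE ?gt_eqF// ?mulr_gt0 ?expR_gt0//.
by rewrite normal_peak_gt0// gt_eqF.
Qed.

Definition gauss_vec (n : nat) (s : R) : probability (pspace 'I_n R) R :=
  pprob (fun _ : 'I_n => normal_prob 0 s).

Definition sqn (n : nat) (x : 'I_n -> R) : R := \sum_(i < n) x i ^+ 2.

Lemma integral_gauss_vec n (s h b : R) (y : 'I_n -> R) : s != 0 ->
  let D := 1 + 2 * h * b ^+ 2 * s ^+ 2 in 0 < D ->
  (\int[gauss_vec n s]_x (expR (- (h * sqn (fun i => y i + b * x i))))%:E =
   (expR (- (n%:R * (ln D / 2)) - h / D * sqn y))%:E)%E.
Proof.
move=> s0 D D0.
under eq_integral => x _.
  rewrite /sqn mulr_sumr -sumrN expR_sum; over.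
rewrite (ge0_integral_pprob_prod (fun _ => normal_prob 0 s)
  (f := fun i a => expR (- (h * (y i + b * a) ^+ 2)))); last 2 first.
- by move=> i; exact: measurable_expR_sqr.
- by move=> i a; rewrite expR_ge0.
under eq_bigr do rewrite integral_normal_expR_sqr// mulr0 addr0.
rewrite -(big_morph EFin EFinM erefl) -expR_sum; congr (expR _)%:E.
by rewrite big_split /= !sumrN sumr_const card_ord -mulr_sumr -/D [in RHS]mulr_natl.
Qed.

Lemma integral_gauss_vec_tilt n (su sg h b : R) (y M : 'I_n -> R) :
  0 < su -> 0 < sg ->
  let D := 1 + 2 * h * b ^+ 2 * sg ^+ 2 in 0 < D ->
  (\int[gauss_vec n su]_u ((\prod_i tilt su sg (M i) (u i)) *
      expR (- (h * sqn (fun i => y i + b * u i))))%:E =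
   (expR (- (n%:R * (ln D / 2)) - h / D * sqn (fun i => y i + b * M i)))%:E)%E.
Proof.
move=> su0 sg0 D D0.
under eq_integral => x _.
  rewrite /sqn mulr_sumr -sumrN expR_sum -big_split/=; over.
rewrite (ge0_integral_pprob_prod (fun _ => normal_prob 0 su)
  (f := fun i a => tilt su sg (M i) a * expR (- (h * (y i + b * a) ^+ 2)))); last 2 first.
- move=> i; apply: measurable_funM; first exact: measurable_tilt.
  exact: measurable_expR_sqr.
- by move=> i a; rewrite mulr_ge0 ?expR_ge0 ?tilt_ge0.
under eq_bigr => i _.
  rewrite integral_tilt//; last exact: measurable_expR_sqr.
  rewrite integral_normal_expR_sqr// ?gt_eqF//; over.
rewrite -(big_morph EFin EFinM erefl) -expR_sum; congr (expR _)%:E.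
by rewrite big_split /= !sumrN sumr_const card_ord -mulr_sumr -/D [in RHS]mulr_natl.
Qed.

End gaussian_integrals.

(** * Gaussian codebooks *)

Section measurability_tools.
Context {R : realType} {d : measure_display} {U : measurableType d}.

Lemma measurable_fun_inv_gt0 (f : U -> R) : (forall u, 0 < f u) ->
  measurable_fun setT f -> measurable_fun setT (fun u => (f u)^-1).
Proof.
move=> f0 mf; rewrite (_ : (fun u => (f u)^-1) = (fun u => expR (- ln (f u)))).
  apply: measurableT_comp => //; apply: measurableT_comp => //.
  by apply: measurableT_comp => //; exact: measurable_ln.
by apply/funext => u; rewrite expRN lnK// posrE.
Qed.

Lemma measurable_fun_natr (b : U -> bool) : measurable_fun setT b ->
  measurable_fun setT (fun u => (b u)%:R : R).
Proof.
move=> mb; rewrite (_ : (fun u => _) = (fun u => if b u then 1 else 0 : R)).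
  by apply: measurable_fun_ifT => //; exact: measurable_cst.
by apply/funext => u; case: (b u).
Qed.

(** There are finitely many truth tables, each with a measurable preimage. The decoder and the index
    selection are written as functions of such a table so that this lemma applies to them. *)
Lemma measurable_fun_ffun (M : finType) (b : M -> U -> bool)
    (q : {ffun M -> bool} -> bool) :
  (forall m, measurable_fun setT (b m)) ->
  measurable_fun setT (fun u => q [ffun m => b m u]).
Proof.
move=> mb; apply: (measurable_fun_bool true); rewrite setTI.
rewrite [X in measurable X](_ : _ = \bigcup_(phi in [set phi : {ffun M -> bool} | q phi])
    \bigcap_(m in [set: M]) (b m @^-1` [set phi m])); last first.
  apply/seteqP; split => u /=.
    by move=> qu; exists [ffun m => b m u] => // m _ /=; rewrite ffunE.
  move=> [phi /= qphi bu]; rewrite (_ : [ffun m => b m u] = phi)//.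
  by apply/ffunP => m; rewrite ffunE; exact: bu.
apply: fin_bigcup_measurable; first exact: finite_finset.
move=> phi _; apply: fin_bigcap_measurable; first exact: finite_finset.
by move=> m _; rewrite -[X in measurable X]setTI; exact: mb.
Qed.

Lemma measurable_sqn (n : nat) (y : U -> 'I_n -> R) :
  (forall i, measurable_fun setT (fun u => y u i)) ->
  measurable_fun setT (fun u => sqn (y u)).
Proof.
by move=> my; apply: measurable_sum => i; apply: measurable_funX; exact: my.
Qed.

Lemma measurable_expR_sqn (n : nat) (h b : R) (y z : U -> 'I_n -> R) :
  (forall i, measurable_fun setT (fun u => y u i)) ->
  (forall i, measurable_fun setT (fun u => z u i)) ->
  measurable_fun setT (fun u => expR (- (h * sqn (fun i => y u i + b * z u i)))).
Proof.
move=> my mz; apply: measurableT_comp => //; apply: measurableT_comp => //.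
apply: measurable_funM; first exact: measurable_cst.
apply: measurable_sqn => i; apply: measurable_funD; first exact: my.
by apply: measurable_funM; [exact: measurable_cst|exact: mz].
Qed.

Lemma measurable_prod_tilt (n : nat) su sg (M y : U -> 'I_n -> R) :
  0 < su -> 0 < sg ->
  (forall i, measurable_fun setT (fun u => M u i)) ->
  (forall i, measurable_fun setT (fun u => y u i)) ->
  measurable_fun setT (fun u => \prod_i tilt su sg (M u i) (y u i)).
Proof.
move=> su0 sg0 mM my; apply: measurable_prod => i _.
under eq_fun do rewrite tiltE//.
apply: measurableT_comp => //; apply: measurable_funD; first exact: measurable_cst.
apply: measurable_funB.
  apply: measurable_funM => //.
  by apply: measurable_funM => //; apply: measurable_funX; exact: my.
apply: measurable_funM => //; apply: measurable_funM => //.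
by apply: measurable_funX; apply: measurable_funB; [exact: my|exact: mM].
Qed.

End measurability_tools.

(** * Integrating out one codeword *)

Section gaussian_codebook.
Context {R : realType} {n : nat} {J : finType}.
Variable sd : J -> R.
Notation X := (pspace J (pspace 'I_n R)).

Definition codebook_law : probability X R := pprob (fun j => gauss_vec n (sd j)).

Lemma measurable_entry (j : J) (i : 'I_n) :
  measurable_fun setT (fun x : X => x j i).
Proof.
apply: (@measurable_coord_comp _ _ _ _ _ (fun x : X => x j)).
exact: measurable_coord.
Qed.

Lemma measurable_codebook_expR (C h : R) (y : X -> 'I_n -> R) :
  (forall i, measurable_fun setT (fun x => y x i)) ->
  measurable_fun setT (fun x => expR (C - h * sqn (y x))).
Proof.
move=> my; apply: measurableT_comp => //; apply: measurable_funB => //.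
by apply: measurable_funM => //; exact: measurable_sqn.
Qed.

(** [K] collects the factors that do not see the codeword [j]; resampling [j] leaves a Gaussian
    integral with [K x] and [y x] as constants. *)
Lemma integral_codebook_sqn (j : J) (h b : R) (K : X -> R) (y : X -> 'I_n -> R) :
  sd j != 0 ->
  measurable_fun setT K -> (forall x, 0 <= K x) ->
  (forall x a, K (update x j a) = K x) ->
  (forall i, measurable_fun setT (fun x => y x i)) ->
  (forall x a, y (update x j a) = y x) ->
  let D := 1 + 2 * h * b ^+ 2 * sd j ^+ 2 in 0 < D ->
  (\int[codebook_law]_x
     (K x * expR (- (h * sqn (fun i => y x i + b * x j i))))%:E =
   \int[codebook_law]_x
     (K x * expR (- (n%:R * (ln D / 2)) - h / D * sqn (y x)))%:E)%E.
Proof.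
move=> sj mK K0 Kj my yj D D0.
rewrite (ge0_integral_pprob_update _ j)/=; last 2 first.
- apply/measurable_EFinP; apply: measurable_funM; first exact: mK.
  by apply: measurable_expR_sqn; [exact: my|exact: measurable_entry].
- by move=> x; rewrite lee_fin mulr_ge0// expR_ge0.
apply: eq_integral => x _.
under eq_integral do rewrite Kj yj update_same EFinM.
rewrite ge0_integralZl//=; last 2 first.
- apply/measurable_EFinP; apply: (@measurable_expR_sqn R _ (pspace 'I_n R) n h b (fun=> y x) (fun u => u)).
    by move=> i; exact: measurable_cst.
  exact: measurable_coord.
- by rewrite lee_fin.
by rewrite integral_gauss_vec// EFinM.
Qed.

Lemma integral_codebook_tilt (j : J) (su sg h b : R) (K : X -> R)
    (M y : X -> 'I_n -> R) : sd j = su -> 0 < su -> 0 < sg ->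
  measurable_fun setT K -> (forall x, 0 <= K x) ->
  (forall x a, K (update x j a) = K x) ->
  (forall i, measurable_fun setT (fun x => M x i)) ->
  (forall x a, M (update x j a) = M x) ->
  (forall i, measurable_fun setT (fun x => y x i)) ->
  (forall x a, y (update x j a) = y x) ->
  let D := 1 + 2 * h * b ^+ 2 * sg ^+ 2 in 0 < D ->
  (\int[codebook_law]_x
     (K x * ((\prod_i tilt su sg (M x i) (x j i)) *
        expR (- (h * sqn (fun i => y x i + b * x j i)))))%:E =
   \int[codebook_law]_x
     (K x * expR (- (n%:R * (ln D / 2)) -
        h / D * sqn (fun i => y x i + b * M x i)))%:E)%E.
Proof.
move=> sj su0 sg0 mK K0 Kj mM Mj my yj D D0.
rewrite (ge0_integral_pprob_update _ j)/=; last 2 first.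
- apply/measurable_EFinP; apply: measurable_funM; first exact: mK.
  apply: measurable_funM.
    by apply: (measurable_prod_tilt su0 sg0 mM); exact: measurable_entry.
  by apply: measurable_expR_sqn; [exact: my|exact: measurable_entry].
- move=> x; rewrite lee_fin !mulr_ge0// ?expR_ge0//.
  by apply: prodr_ge0 => i _; exact: tilt_ge0.
apply: eq_integral => x _.
under eq_integral do rewrite Kj Mj yj update_same EFinM.
rewrite ge0_integralZl//=; last 3 first.
- apply/measurable_EFinP; apply: measurable_funM.
    apply: (@measurable_prod_tilt R _ (pspace 'I_n R) n su sg (fun=> M x) (fun u => u) su0 sg0).
      by move=> i; exact: measurable_cst.
    exact: measurable_coord.
  apply: (@measurable_expR_sqn R _ (pspace 'I_n R) n h b (fun=> y x) (fun u => u)).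
    by move=> i; exact: measurable_cst.
  exact: measurable_coord.
- move=> a _; rewrite lee_fin mulr_ge0 ?expR_ge0//.
  by apply: prodr_ge0 => i _; exact: tilt_ge0.
- by rewrite lee_fin.
by rewrite sj integral_gauss_vec_tilt// EFinM.
Qed.

End gaussian_codebook.

(** * The AM-GM bound behind soft encoding and decoding *)

Section pointwise.
Context {R : realType}.

(* AM-GM: [1 / (p q) + p + q >= 3]. *)
Lemma likelihood_tangent (L w v X Y d : R) : 0 < L -> 0 < w -> 0 < v ->
  0 <= X -> 0 <= Y -> v / (v + Y) <= d ->
  3 * (w / L) <= w / (w + X) * d + w / L * ((w + X) / L + (v + Y) / v).
Proof.
move=> L0 w0 v0 X0 Y0 dv.
have wX : 0 < w + X by rewrite ltr_wpDr.
have vY : 0 < v + Y by rewrite ltr_wpDr.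
apply: (@le_trans _ _ (w / (w + X) * (v / (v + Y)) +
    w / L * ((w + X) / L + (v + Y) / v))); last first.
  by rewrite lerD2r ler_wpM2l// divr_ge0// ltW.
pose p := (w + X) / L; pose q := (v + Y) / v.
have p0 : 0 < p by rewrite divr_gt0.
have q0 : 0 < q by rewrite divr_gt0.
rewrite (_ : w / (w + X) * (v / (v + Y)) = w / L * (p * q)^-1); last first.
  by rewrite /p /q; field; rewrite !gt_eqF.
rewrite -mulrDr [leLHS]mulrC ler_wpM2l//; first by rewrite divr_ge0// ltW.
rewrite -/p -/q; clearbody p q.
have pq0' : 0 < p * q by rewrite mulr_gt0.
rewrite -(ler_pM2r pq0') [leRHS]mulrDl mulVf ?gt_eqF//.
have pq0 : 0 <= p * q by rewrite mulr_ge0 ?ltW.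
(* AM-GM in two moves: [p + q >= 2 * s] with [s] the square root of [p * q], then 1/s^2 + 2s >= 3,
   which after clearing denominators is (s - 1)^2 (2s + 1) >= 0. *)
have s0 := sqrtr_ge0 (p * q); have := sqr_sqrtr pq0.
move: s0; set s := Num.sqrt _ => s0 s2.
have pqs : 2 * s <= p + q.
  have := sqr_ge0 (p - q); rewrite -(ler_pXn2r (n := 2))// ?nnegrE; first nra.
    by rewrite mulr_ge0.
  by rewrite addr_ge0// ltW.
rewrite -s2; have : 0 <= s ^+ 2 * (p + q - 2 * s) by rewrite mulr_ge0 ?sqr_ge0 ?subr_ge0.
have : 0 <= (s - 1) ^+ 2 * (2 * s + 1).
  by rewrite mulr_ge0 ?sqr_ge0// addr_ge0// mulr_ge0.
lra.
Qed.

End pointwise.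

(** * Joint law of state and noise *)

Lemma exists_lt_integral (R : realType) (d : measure_display) (T : measurableType d)
    (m : probability T R) (F : T -> \bar R) (B : R) :
  measurable_fun setT F -> (forall x, 0 <= F x)%E -> 0 <= B ->
  (\int[m]_x F x < B%:E)%E -> exists x, (F x < B%:E)%E.
Proof.
move=> mF F0 B0 FB; apply/not_existsP => nF; move: FB; apply/negP; rewrite -leNgt.
have <- : (\int[m]_x B%:E = B%:E)%E by rewrite integral_cst//= probability_setT mule1.
apply: ge0_le_integral => //.
by move=> x _; rewrite leNgt; apply/negP; exact: nF.
Qed.

Section state_noise_law.
Context {R : realType} {n : nat}.
Notation vec := (pspace 'I_n R).
Notation flat := (pspace (bool * 'I_n)%type R).

(** State and noise become one family of scalars, so that agreement on rectangles of scalar sets,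
    which is what the independence hypothesis provides, determines their joint law. *)
Definition join_vec (p : vec * vec) : flat :=
  fun bi => if bi.1 then p.1 bi.2 else p.2 bi.2.

Definition split_vec (f : flat) : vec * vec :=
  (fun i => f (true, i), fun i => f (false, i)).

Lemma measurable_join_vec : measurable_fun setT join_vec.
Proof.
apply: measurable_pspace => -[[] i] /=.
  by apply: (@measurable_coord_comp _ _ _ _ _ fst); exact: measurable_fst.
by apply: (@measurable_coord_comp _ _ _ _ _ snd); exact: measurable_snd.
Qed.

HB.instance Definition _ := isMeasurableFun.Build _ _ _ _ _ measurable_join_vec.

Lemma measurable_split_vec : measurable_fun setT split_vec.
Proof.
by apply: measurable_fun_pair; apply: measurable_pspace => i; exact: measurable_coord.
Qed.

Context {d : measure_display} {T : measurableType d} (P : probability T R).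
Variables S Z : nat -> {RV P >-> R}.

Definition state_noise (t : T) : vec * vec :=
  (fun i : 'I_n => S i t, fun i : 'I_n => Z i t).

Lemma measurable_state_noise : measurable_fun setT state_noise.
Proof. by apply: measurable_fun_pair; apply: measurable_pspace => i. Qed.

Definition flat_state_noise (t : T) : flat := join_vec (state_noise t).

Lemma measurable_flat_state_noise : measurable_fun setT flat_state_noise.
Proof.
apply: (measurableT_comp measurable_join_vec); exact: measurable_state_noise.
Qed.

HB.instance Definition _ := isMeasurableFun.Build _ _ _ _ _ measurable_flat_state_noise.

Lemma state_noise_law (Q N : R) (A : set (vec * vec)) :
  gauss_state_noise Q N S Z -> measurable A ->
  P (state_noise @^-1` A) =
  (gauss_vec n (Num.sqrt Q) \x gauss_vec n (Num.sqrt N))%E A.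
Proof.
move=> [lawS [lawZ ind]] mA.
pose m1 := distribution P flat_state_noise.
pose m2 := distribution (gauss_vec n (Num.sqrt Q) \x gauss_vec n (Num.sqrt N))%E join_vec.
have splitK p : split_vec (join_vec p) = p by case: p.
have m12 : forall B, measurable B -> m1 B = m2 B.
  apply: pspace_measure_unique => B mB.
  (* Independence is stated for sequences of sets indexed by [nat]; the [n] given sets are extended
     by [setT]. *)
  pose BS (i : nat) := if insub i is Some j then B (true, j) else setT.
  pose BZ (i : nat) := if insub i is Some j then B (false, j) else setT.
  have BSE (i : 'I_n) : BS i = B (true, i) by rewrite /BS valK.
  have BZE (i : 'I_n) : BZ i = B (false, i) by rewrite /BZ valK.
  have mBS i : measurable (BS i) by rewrite /BS; case: insub.
  have mBZ i : measurable (BZ i) by rewrite /BZ; case: insub.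
  transitivity (\prod_(i < n) (P (S i @^-1` BS i) * P (Z i @^-1` BZ i)))%E.
    rewrite -ind// /m1 /distribution /pushforward; congr (P _).
    apply/seteqP; split => t /=.
      move=> h i /= ilt; rewrite (BSE (Ordinal ilt)) (BZE (Ordinal ilt)); split.
        exact: (h (true, Ordinal ilt)).
      exact: (h (false, Ordinal ilt)).
    move=> h [[] i] /=; have [] := h i (ltn_ord i); by rewrite BSE BZE.
  rewrite /m2 /distribution /pushforward /=.
  rewrite [X in product_measure1 _ _ X](_ : _ =
      rect (fun i => B (true, i)) `*` rect (fun i => B (false, i))); last first.
    apply/seteqP; split => -[u v] /=.
      by move=> h; split => i; [exact: (h (true, i))|exact: (h (false, i))].
    by move=> [h1 h2] [[] i] /=; [exact: h1|exact: h2].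
  rewrite product_measure1E//; [|exact: measurable_rect|exact: measurable_rect].
  have gvr (s : R) (C : 'I_n -> set R) : (forall i, measurable (C i)) ->
      gauss_vec n s (rect C) = (\prod_(i < n) normal_prob 0 s (C i))%E.
    move=> mC; exact (@pprob_rect R 'I_n _ _ (fun _ => normal_prob 0 s) C mC).
  transitivity ((\prod_(i < n) normal_prob 0 (Num.sqrt Q) (B (true, i))) *
    \prod_(i < n) normal_prob 0 (Num.sqrt N) (B (false, i)))%E; last first.
    by congr (_ * _)%E; rewrite -gvr.
  rewrite big_split/=; congr (_ * _)%E; apply: eq_bigr => i _.
    by rewrite lawS// BSE.
  by rewrite lawZ// BZE.
have mA' : measurable (split_vec @^-1` A).
  by rewrite -[X in measurable X]setTI; exact: measurable_split_vec.
have := m12 _ mA'; rewrite /m1 /m2 /distribution /pushforward /=.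
rewrite (_ : flat_state_noise @^-1` _ = state_noise @^-1` A); last first.
  by apply/seteqP; split => t /=; rewrite /flat_state_noise splitK.
by move=> ->; congr (product_measure1 _ _ _); apply/seteqP; split => t /=; rewrite splitK.
Qed.

End state_noise_law.

(** * Random coding *)

Section gaussian_marginalization.
Context {R : realType} {n : nat}.

(* [gweight h sigma y] is, up to normalization, the weight [expR (- h * sqn y)]
   after a Gaussian vector of variance [sigma] has been integrated out of [y].
   *)
Definition gweight (h sigma : R) (y : 'I_n -> R) : R :=
  expR (- (n%:R * (ln (1 + 2 * h * sigma) / 2)) -
    h / (1 + 2 * h * sigma) * sqn y).

Lemma gweight0 h y : gweight h 0 y = expR (- (h * sqn y)).
Proof.
by rewrite /gweight !mulr0 addr0 ln1 mul0r mulr0 oppr0 add0r divr1.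
Qed.

Lemma gweight_ge0 h sigma y : 0 <= gweight h sigma y.
Proof. exact: expR_ge0. Qed.

Context {J : finType}.
Variable sd : J -> R.
Notation X := (pspace J (pspace 'I_n R)).
Notation law := (@codebook_law R n J sd).

Lemma measurable_gweight h sigma (y : X -> 'I_n -> R) :
  (forall i, measurable_fun setT (fun x => y x i)) ->
  measurable_fun setT (fun x => gweight h sigma (y x)).
Proof. by move=> my; exact: measurable_codebook_expR. Qed.

(** Variances add: the factor produced by one more Gaussian integration is the quotient of the new
    [1 + 2 * h * sigma] by the old one, so repeated integrations telescope. *)
Lemma integral_gweight (j : J) (h sigma b : R) (K : X -> R)
    (y : X -> 'I_n -> R) :
  sd j != 0 ->
  measurable_fun setT K -> (forall x, 0 <= K x) ->
  (forall x u, K (update x j u) = K x) ->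
  (forall i, measurable_fun setT (fun x => y x i)) ->
  (forall x u, y (update x j u) = y x) ->
  0 < 1 + 2 * h * sigma -> 0 < 1 + 2 * h * (sigma + b ^+ 2 * sd j ^+ 2) ->
  (\int[law]_x (K x * gweight h sigma (fun i => y x i + b * x j i))%:E =
   \int[law]_x (K x * gweight h (sigma + b ^+ 2 * sd j ^+ 2) (y x))%:E)%E.
Proof.
move=> sj mK K0 Kj my yj D0 D1.
pose D := 1 + 2 * h * sigma.
pose C := expR (- (n%:R * (ln D / 2))).
have DN0 : 1 + 2 * h * sigma != 0 by rewrite gt_eqF.
have DE : 1 + 2 * (h / D) * b ^+ 2 * sd j ^+ 2 =
    (1 + 2 * h * (sigma + b ^+ 2 * sd j ^+ 2)) / D.
  by rewrite /D; field.
transitivity (\int[law]_x ((K x * C) *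
    expR (- (h / D * sqn (fun i => y x i + b * x j i))))%:E)%E.
  by apply: eq_integral => x _; rewrite /gweight expRD mulrA.
have mKC : measurable_fun setT (fun x => K x * C) by exact: measurable_funM.
have KC0 x : 0 <= K x * C by rewrite mulr_ge0// expR_ge0.
have KCj x u : K (update x j u) * C = K x * C by rewrite Kj.
have DE0 : 0 < 1 + 2 * (h / D) * b ^+ 2 * sd j ^+ 2 by rewrite DE divr_gt0.
etransitivity.
  exact: (integral_codebook_sqn sj mKC KC0 KCj my yj DE0).
apply: eq_integral => x _; rewrite -mulrA; congr (_ * _)%:E.
rewrite /gweight /C -expRD DE ln_div ?posrE//.
congr expR; rewrite (_ : h / D / (_ / D) =
  h / (1 + 2 * h * (sigma + b ^+ 2 * sd j ^+ 2))); first by rewrite /D; lra.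
by rewrite /D; field; rewrite DN0 exprMn gt_eqF.
Qed.

Lemma integral_gweight_tilt (j : J) (su sg h b : R) (K : X -> R)
    (M y : X -> 'I_n -> R) : sd j = su -> 0 < su -> 0 < sg ->
  measurable_fun setT K -> (forall x, 0 <= K x) ->
  (forall x u, K (update x j u) = K x) ->
  (forall i, measurable_fun setT (fun x => M x i)) ->
  (forall x u, M (update x j u) = M x) ->
  (forall i, measurable_fun setT (fun x => y x i)) ->
  (forall x u, y (update x j u) = y x) ->
  0 < 1 + 2 * h * (b ^+ 2 * sg ^+ 2) ->
  (\int[law]_x (K x * ((\prod_i tilt su sg (M x i) (x j i)) *
      gweight h 0 (fun i => y x i + b * x j i)))%:E =
   \int[law]_x (K x * gweight h (b ^+ 2 * sg ^+ 2)
      (fun i => y x i + b * M x i))%:E)%E.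
Proof.
move=> sj su0 sg0 mK K0 Kj mM Mj my yj D0.
under eq_integral do rewrite gweight0.
rewrite (integral_codebook_tilt sj su0 sg0 mK K0 Kj mM Mj my yj)/=; last first.
  by rewrite -(mulrA (2 * h)).
by apply: eq_integral => x _; rewrite /gweight -(mulrA (2 * h)).
Qed.

End gaussian_marginalization.

Section random_coding.
Context {R : realType}.
Variables (n mc m1 ll : nat).
Variables (a b cc r al be e sQ sN su sg eta P1 P2 : R).
Hypotheses (sQ0 : 0 < sQ) (sN0 : 0 < sN) (su0 : 0 < su) (sg0 : 0 < sg).
Hypotheses (e0 : 0 < e) (eta0 : 0 < eta).
Let k := 1 + r.
Let ka := a + cc.
(** These three identities describe U = al k S + G: [su] is its marginal deviation, [e] the variance
    of what is left of k S + G + Z after subtracting [be] U, and the third makes this remainder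
    uncorrelated with [be] U. *)
Hypothesis suE : su ^+ 2 = (al * k) ^+ 2 * sQ ^+ 2 + sg ^+ 2.
Hypothesis eE :
  (k * (1 - al) + (1 - be) * (al * k)) ^+ 2 * sQ ^+ 2 + (1 - be) ^+ 2 * sg ^+ 2 +
    sN ^+ 2 = e.
Hypothesis e2E : e + be ^+ 2 * su ^+ 2 = k ^+ 2 * sQ ^+ 2 + sg ^+ 2 + sN ^+ 2.
Hypothesis P1E : (a ^+ 2 + b ^+ 2) * (1 + eta) <= P1.
Hypothesis P2E : (cc ^+ 2 + r ^+ 2 * sQ ^+ 2 + sg ^+ 2) * (1 + eta) <= P2.
Hypothesis b0 : b != 0.

Notation vec := (pspace 'I_n R).
(* Besides the three families of codewords, the index type has the two entries
   [jS] and [jZ], so that state and noise are two more coordinates of the same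
   product space. *)
Let J : finType :=
  ('I_mc.+1 + 'I_mc.+1 * 'I_m1.+1 + 'I_mc.+1 * 'I_ll.+1 + bool)%type.
Let jV (c : 'I_mc.+1) : J := inl (inl (inl c)).
Let jX (c : 'I_mc.+1) (w : 'I_m1.+1) : J := inl (inl (inr (c, w))).
Let jU (c : 'I_mc.+1) (l : 'I_ll.+1) : J := inl (inr (c, l)).
Let jS : J := inr true.
Let jZ : J := inr false.
Notation X := (pspace J vec).

(** V and X have unit variance, their amplitudes being coefficients of the linear forms. U gets its
    marginal deviation [su], independently of S; their correlation enters only through [tw]. *)
Definition sdev (j : J) : R :=
  match j with
  | inl (inr _) => su
  | inr true => sQ
  | inr false => sN
  | _ => 1
  end.

Let law := @codebook_law R n J sdev.

Lemma sdev_neq0 j : sdev j != 0.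
Proof. by move: j => [[[c|cw]|cl]|[]] /=; rewrite ?oner_neq0// gt_eqF. Qed.

Record lform := LForm { cV : R; cX : R; cS : R; cU : R; cZ : R }.

Definition lin (f : lform) (V X U S Z : vec) : vec := fun i =>
  cV f * V i + cX f * X i + cZ f * Z i + cS f * S i + cU f * U i.

(* The variance of [lin f] when [U = al * k * S + G] with [G] of variance [sg ^+
   2] independent of [S]. *)
Definition lvar (f : lform) : R :=
  cV f ^+ 2 + cX f ^+ 2 + (cS f + cU f * (al * k)) ^+ 2 * sQ ^+ 2 +
  cU f ^+ 2 * sg ^+ 2 + cZ f ^+ 2 * sN ^+ 2.

Definition tw (S U : vec) : R := \prod_i tilt su sg (al * k * S i) (U i).

Lemma tw_ge0 S U : 0 <= tw S U.
Proof. by apply: prodr_ge0 => i _; exact: tilt_ge0. Qed.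

Lemma twE S U : tw S U = expR (n%:R * (ln (su ^+ 2 / sg ^+ 2) / 2) +
  (sqn U / su ^+ 2 / 2 - sqn (fun i => U i - al * k * S i) / sg ^+ 2 / 2)).
Proof.
rewrite /tw; under eq_bigr do rewrite tiltE//.
rewrite -expR_sum; congr expR.
rewrite big_split/= sumr_const card_ord [in RHS]mulr_natl; congr (_ + _).
by rewrite sumrB -!mulr_suml.
Qed.

Lemma tw_gt0 S U : 0 < tw S U.
Proof. by rewrite twE expR_gt0. Qed.

Definition mvec (d : measure_display) (U : measurableType d) (y : U -> vec) :=
  forall i, measurable_fun setT (fun u => y u i).

Lemma mvec_coord j : mvec (fun x : X => x j).
Proof. by move=> i; exact: measurable_entry. Qed.

Lemma mvec_lin (d : measure_display) (T : measurableType d) f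
    (V X U S Z : T -> vec) :
  mvec V -> mvec X -> mvec U -> mvec S -> mvec Z ->
  mvec (fun t => lin f (V t) (X t) (U t) (S t) (Z t)).
Proof.
move=> mV mX mU mS mZ i; rewrite /lin.
by do !apply: measurable_funD; apply: measurable_funM.
Qed.

Lemma measurable_tw (d : measure_display) (T : measurableType d)
    (S U : T -> vec) : mvec S -> mvec U ->
  measurable_fun setT (fun t => tw (S t) (U t)).
Proof.
move=> mS mU; apply: measurable_prod_tilt => // i.
by apply: measurable_funM => //; exact: mS.
Qed.

Let lf (f : lform) (x : X) c w l : vec :=
  lin f (x (jV c)) (x (jX c w)) (x (jU c l)) (x jS) (x jZ).

(** U is integrated before S because its tilted mean depends on S; each further integration adds a
    variance until the sum is [lvar f]. Negative [h] is allowed, as the upper tails require. *)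
Lemma integral_tw_expR (f : lform) (h : R) c w l :
  0 < 1 + 2 * h * lvar f ->
  (\int[law]_x (tw (x jS) (x (jU c l)) * expR (- (h * sqn (lf f x c w l))))%:E =
   (expR (- (n%:R * (ln (1 + 2 * h * lvar f) / 2))))%:E)%E.
Proof.
move=> D0.
(* For negative [h] the factor decreases in [s], so its positivity at [lvar f] covers all partial
   variances. *)
have pos s : 0 <= s <= lvar f -> 0 < 1 + 2 * h * s.
  move=> /andP[s0 sl]; have [h0|h0] := leP 0 h.
    by rewrite ltr_wpDr// !mulr_ge0.
  by nra.
have v0 := sqr_ge0 (cV f). have x0 := sqr_ge0 (cX f).
have u0 : 0 <= cU f ^+ 2 * sg ^+ 2 by rewrite mulr_ge0 ?sqr_ge0.
have z0 : 0 <= cZ f ^+ 2 * sN ^+ 2 by rewrite mulr_ge0 ?sqr_ge0.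
have s0 : 0 <= (cS f + cU f * (al * k)) ^+ 2 * sQ ^+ 2 by rewrite mulr_ge0 ?sqr_ge0.
pose y1 (x : X) : vec := fun i => cV f * x (jV c) i + cX f * x (jX c w) i +
  cZ f * x jZ i + cS f * x jS i.
have mentry j i : measurable_fun setT (fun x : X => x j i).
  exact: measurable_entry.
transitivity (\int[law]_x (1 * ((\prod_i tilt su sg (al * k * x jS i) (x (jU c l) i)) *
    gweight h 0 (fun i => y1 x i + cU f * x (jU c l) i)))%:E)%E.
  by apply: eq_integral => x _; rewrite mul1r gweight0.
rewrite (@integral_gweight_tilt _ _ _ sdev (jU c l) su sg h (cU f) (fun=> 1)
  (fun x i => al * k * x jS i))//=; last 3 first.
- by move=> i; apply: measurable_funM => //; exact: mentry.
- by move=> i; do !apply: measurable_funD; apply: measurable_funM => //; exact: mentry.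
- by apply: pos; rewrite /lvar; lra.
pose y2 (x : X) : vec := fun i => cV f * x (jV c) i + cX f * x (jX c w) i +
  cZ f * x jZ i.
transitivity (\int[law]_x (1 * gweight h (cU f ^+ 2 * sg ^+ 2)
   (fun i => y2 x i + (cS f + cU f * (al * k)) * x jS i))%:E)%E.
  apply: eq_integral => x _; congr (_ * gweight _ _ _)%:E.
  by apply/funext => i; rewrite /y1 /y2; ring.
rewrite (@integral_gweight _ _ _ sdev jS h _ _ (fun=> 1) y2)//=; last 4 first.
- by rewrite gt_eqF.
- by move=> i; do !apply: measurable_funD; apply: measurable_funM => //; exact: mentry.
- by apply: pos; rewrite /lvar; lra.
- by apply: pos; rewrite /lvar; lra.
pose y3 (x : X) : vec := fun i => cV f * x (jV c) i + cX f * x (jX c w) i.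
rewrite (@integral_gweight _ _ _ sdev jZ h _ _ (fun=> 1) y3)//=; last 4 first.
- by rewrite gt_eqF.
- by move=> i; do !apply: measurable_funD; apply: measurable_funM => //; exact: mentry.
- by apply: pos; rewrite /lvar; lra.
- by apply: pos; rewrite /lvar; lra.
pose y4 (x : X) : vec := fun i => cV f * x (jV c) i.
rewrite (@integral_gweight _ _ _ sdev (jX c w) h _ _ (fun=> 1) y4)//=; last 3 first.
- by move=> i; apply: measurable_funM => //; exact: mentry.
- by apply: pos; rewrite /lvar; lra.
- by apply: pos; rewrite /lvar; lra.
transitivity (\int[law]_x (1 * gweight h (cU f ^+ 2 * sg ^+ 2 +
   (cS f + cU f * (al * k)) ^+ 2 * sQ ^+ 2 + cZ f ^+ 2 * sN ^+ 2 +
   cX f ^+ 2 * 1 ^+ 2)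
   (fun i => 0 + cV f * x (jV c) i))%:E)%E.
  apply: eq_integral => x _; congr (_ * gweight _ _ _)%:E.
  by apply/funext => i; rewrite add0r.
rewrite (@integral_gweight _ _ _ sdev (jV c) h _ _ (fun=> 1) (fun _ _ => 0))//=; last 2 first.
- by apply: pos; rewrite /lvar; lra.
- by apply: pos; rewrite /lvar; lra.
under eq_integral => x _.
  rewrite mul1r /gweight /sqn big1; last by move=> i _; rewrite expr0n.
  rewrite mulr0 subr0; over.
rewrite integral_cst//= probability_setT mule1.
rewrite (_ : _ + cV f ^+ 2 * 1 ^+ 2 = lvar f)//.
by rewrite /lvar; ring.
Qed.

(** * Concentration of the quadratic forms under the tilted law *)

Let kappa := eta ^+ 2 / (4 * (2 + eta)).

Lemma ln1D_ge (u : R) : 0 < 1 + 2 * u -> 2 * u / (1 + 2 * u) <= ln (1 + 2 * u).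
Proof.
move=> u0; have i0 : 0 < (1 + 2 * u)^-1 by rewrite invr_gt0.
have : ln (1 + ((1 + 2 * u)^-1 - 1)) <= (1 + 2 * u)^-1 - 1.
  by apply: le_ln1Dx; rewrite ltrBrDr addNr.
rewrite (addrC 1 (_ - 1)) subrK lnV ?posrE//.
rewrite (_ : 2 * u / (1 + 2 * u) = 1 - (1 + 2 * u)^-1); last first.
  by field; rewrite gt_eqF.
lra.
Qed.

Lemma measurable_sqn_lf f c w l :
  measurable_fun setT (fun x : X => sqn (lf f x c w l)).
Proof. by apply: measurable_sqn; apply: mvec_lin; exact: mvec_coord. Qed.

Lemma measurable_tw_entry c l :
  measurable_fun setT (fun x : X => tw (x jS) (x (jU c l))).
Proof. by apply: measurable_tw; exact: mvec_coord. Qed.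

(** The sign of [u] selects the tail: positive for the lower one, negative for the upper one.
    [ln1D_ge] replaces the logarithm by a rational function, so that exponents can be compared by
    field arithmetic. *)
Lemma tilted_chernoff f (theta u : R) c w l : 0 < lvar f -> 0 < 1 + 2 * u ->
  (\int[law]_x (tw (x jS) (x (jU c l)) *
      (u * sqn (lf f x c w l) <= u * (n%:R * lvar f * theta))%R%:R)%:E <=
   (expR (n%:R * (u * theta - u / (1 + 2 * u))))%:E)%E.
Proof.
move=> f0 u0; pose h := u / lvar f.
have hu : h * lvar f = u by rewrite /h divfK// gt_eqF.
have D0 : 0 < 1 + 2 * h * lvar f by rewrite -mulrA hu.
apply: (@le_trans _ _ (\int[law]_x ((expR (n%:R * (u * theta)))%:E *
    (tw (x jS) (x (jU c l)) * expR (- (h * sqn (lf f x c w l))))%:E))%E).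
  apply: ge0_le_integral => //.
  - by move=> x _; rewrite lee_fin mulr_ge0 ?tw_ge0.
  - apply/measurable_EFinP; apply: measurable_funM.
      exact: measurable_tw_entry.
    apply: measurable_fun_natr; apply: measurable_fun_ler => //.
    by apply: measurable_funM => //; exact: measurable_sqn_lf.
  - apply: emeasurable_funM => //; apply/measurable_EFinP; apply: measurable_funM.
      exact: measurable_tw_entry.
    apply: measurableT_comp => //; apply: measurableT_comp => //.
    by apply: measurable_funM => //; exact: measurable_sqn_lf.
  - move=> x _; rewrite -EFinM lee_fin [leRHS]mulrCA ler_wpM2l ?tw_ge0// -expRD.
    case: (boolP (u * _ <= _)) => [ux|_] /=; last exact: expR_ge0.
    rewrite -[leLHS]expR0 ler_expR subr_ge0 /h mulrAC ler_pdivrMr//.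
    by apply: (le_trans ux); rewrite le_eqVlt; apply/orP; left; apply/eqP; ring.
rewrite ge0_integralZl//; last 2 first.
- apply/measurable_EFinP; apply: measurable_funM.
    exact: measurable_tw_entry.
  apply: measurableT_comp => //; apply: measurableT_comp => //.
  by apply: measurable_funM => //; exact: measurable_sqn_lf.
- by move=> x _; rewrite lee_fin mulr_ge0 ?tw_ge0 ?expR_ge0.
rewrite integral_tw_expR// -EFinM lee_fin -expRD ler_expR -mulrBr.
rewrite ler_wpM2l// lerB// -(mulrA 2) hu.
by have := ln1D_ge u0; rewrite -mulrA; lra.
Qed.

(** For [u = - tt] one has 1 + 2u = 1/(1 + eta/2), a rational stand-in for 1/sqrt(1 + eta), where
    the exponent u(1 + eta) - u/(1 + 2u) is minimal. The exponent then equals [- kappa]; the lower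
    tail with [u = tt] does no worse. *)
Let tt := eta / (2 + eta) / 2.

Lemma chernoff_up f c w l : 0 < lvar f ->
  (\int[law]_x (tw (x jS) (x (jU c l)) *
      (n%:R * lvar f * (1 + eta) <= sqn (lf f x c w l))%R%:R)%:E <=
   (expR (- (n%:R * kappa)))%:E)%E.
Proof.
move=> f0.
have e2 : 0 < 2 + eta by rewrite addr_gt0.
have t0 : 0 < tt by rewrite !divr_gt0.
have D0 : 0 < 1 + 2 * - tt.
  rewrite (_ : 1 + 2 * - tt = 2 / (2 + eta)) ?divr_gt0//.
  by rewrite /tt; field; rewrite gt_eqF.
under eq_integral => x _ do rewrite -(@ler_nM2l _ (- tt)) ?oppr_lt0//.
apply: (le_trans (tilted_chernoff (1 + eta) c w l f0 D0)).
rewrite lee_fin ler_expR -[leRHS]mulrN ler_wpM2l//.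
rewrite le_eqVlt; apply/orP; left; apply/eqP; rewrite /tt /kappa; field.
by rewrite addrK !gt_eqF.
Qed.

Lemma chernoff_low f c w l : 0 < lvar f ->
  (\int[law]_x (tw (x jS) (x (jU c l)) *
      (sqn (lf f x c w l) <= n%:R * lvar f * (1 - eta))%R%:R)%:E <=
   (expR (- (n%:R * kappa)))%:E)%E.
Proof.
move=> f0.
have e2 : 0 < 2 + eta by rewrite addr_gt0.
have t0 : 0 < tt by rewrite !divr_gt0.
have D0 : 0 < 1 + 2 * tt by rewrite addr_gt0// mulr_gt0.
under eq_integral => x _ do rewrite -(@ler_pM2l _ tt)//.
apply: (le_trans (tilted_chernoff (1 - eta) c w l f0 D0)).
rewrite lee_fin ler_expR -[leRHS]mulrN ler_wpM2l//.
rewrite -subr_ge0 (_ : _ - _ = eta ^+ 3 / (4 * (2 + eta) * (1 + eta))).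
  by rewrite divr_ge0 ?exprn_ge0 ?mulr_ge0 ?addr_ge0 ?ltW.
rewrite /tt /kappa; field.
by rewrite !gt_eqF ?addr_gt0.
Qed.

(* In order: [U], [G = U - al k S], the output minus everything decodable, then
   the same with [b X], [be U] and [ka V] put back, and the two channel inputs.
   *)
Definition forms : seq lform :=
  [:: LForm 0 0 0 1 0; LForm 0 0 (- (al * k)) 1 0;
      LForm 0 0 (k * (1 - al)) (1 - be) 1; LForm 0 b (k * (1 - al)) (1 - be) 1;
      LForm 0 b (k * (1 - al)) 1 1; LForm ka b (k * (1 - al)) 1 1;
      LForm a b 0 0 0; LForm cc 0 (r - al * k) 1 0].

Definition good (V X U S Z : vec) : bool :=
  all (fun f => (n%:R * lvar f * (1 - eta) <= sqn (lin f V X U S Z)) &&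
    (sqn (lin f V X U S Z) <= n%:R * lvar f * (1 + eta))) forms.

Let gd (x : X) c w l : bool :=
  good (x (jV c)) (x (jX c w)) (x (jU c l)) (x jS) (x jZ).

(** Variance added to the residual by an unknown X, by X and U, and by X, U and V. With [be] the
    minimum mean square coefficient, the numbers ln(1 + s/e)/2 are I(X;Y|U,V), I(X,U;Y|V) and
    I(V,X,U;Y). *)
Let s1 := b ^+ 2.
Let s2 := b ^+ 2 + be ^+ 2 * su ^+ 2.
Let s3 := b ^+ 2 + be ^+ 2 * su ^+ 2 + ka ^+ 2.

Lemma lvar_forms : map lvar forms = [:: su ^+ 2; sg ^+ 2; e; e + s1; e + s2;
  e + s3; a ^+ 2 + b ^+ 2; cc ^+ 2 + r ^+ 2 * sQ ^+ 2 + sg ^+ 2].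
Proof.
have v4 : lvar (LForm 0 b (k * (1 - al)) 1 1) = e + s2.
  rewrite /s2 addrCA e2E /lvar /=; ring.
have v5 : lvar (LForm ka b (k * (1 - al)) 1 1) = e + s3.
  rewrite /s3 addrA -/s2 -v4 /lvar /=; ring.
rewrite /= v4 v5; congr [:: _; _; _; _; _; _; _; _]; rewrite /lvar /=.
- by rewrite suE; ring.
- ring.
- by rewrite -eE; ring.
- by rewrite /s1 -eE; ring.
- ring.
- ring.
Qed.

Lemma all_lvar_gt0 : all (fun f => 0 < lvar f) forms.
Proof.
have -> : all (fun f => 0 < lvar f) forms = all (fun v => 0 < v) (map lvar forms).
  by rewrite all_map.
have b2 : 0 < b ^+ 2 by rewrite exprn_even_gt0.
have := sqr_ge0 (be * su); rewrite exprMn => bs.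
have ka2 := sqr_ge0 ka; have a2 := sqr_ge0 a; have c2 := sqr_ge0 cc.
have r2 : 0 <= r ^+ 2 * sQ ^+ 2 by rewrite mulr_ge0 ?sqr_ge0.
have su2 : 0 < su ^+ 2 by rewrite exprn_gt0.
have sg2 : 0 < sg ^+ 2 by rewrite exprn_gt0.
rewrite lvar_forms /= /s1 /s2 /s3 su2 sg2 e0 /=.
have eP t : 0 <= t -> 0 < e + t by move=> t0; rewrite ltr_wpDr.
by do !(apply/andP; split => //); try (apply: eP); lra.
Qed.

Lemma measurable_good (d : measure_display) (T : measurableType d)
    (V X U S Z : T -> vec) :
  mvec V -> mvec X -> mvec U -> mvec S -> mvec Z ->
  measurable_fun setT (fun t => good (V t) (X t) (U t) (S t) (Z t)).
Proof.
move=> mV mX mU mS mZ; rewrite /good.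
elim: forms => [|f s IH] /=; first exact: measurable_cst.
apply: measurable_and => //; apply: measurable_and; apply: measurable_fun_ler => //.
  by apply: measurable_sqn; exact: mvec_lin.
by apply: measurable_sqn; exact: mvec_lin.
Qed.

Lemma measurable_gd c w l : measurable_fun setT (fun x : X => (gd x c w l)%:R : R).
Proof.
by apply: measurable_fun_natr; apply: measurable_good; exact: mvec_coord.
Qed.

Let upf f x c w l : R := (n%:R * lvar f * (1 + eta) <= sqn (lf f x c w l))%R%:R.
Let lowf f x c w l : R := (sqn (lf f x c w l) <= n%:R * lvar f * (1 - eta))%R%:R.

Lemma measurable_upf f c w l : measurable_fun setT (fun x : X => upf f x c w l).
Proof.
by apply: measurable_fun_natr; apply: measurable_fun_ler => //;
  exact: measurable_sqn_lf.
Qed.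

Lemma measurable_lowf f c w l : measurable_fun setT (fun x : X => lowf f x c w l).
Proof.
by apply: measurable_fun_natr; apply: measurable_fun_ler => //;
  exact: measurable_sqn_lf.
Qed.

(** The union bound over both tails of every form, as an inequality between 0/1 values so that it
    can be integrated against [tw]. *)
Lemma good_cover (x : X) c w l :
  1 <= (gd x c w l)%:R + \sum_(f <- forms) (upf f x c w l + lowf f x c w l).
Proof.
rewrite /gd /good; elim: forms => [|f s IH] /=; first by rewrite big_nil addr0.
rewrite big_cons.
have s0 : 0 <= \sum_(f <- s) (upf f x c w l + lowf f x c w l).
  by apply: sumr_ge0 => f' _; rewrite addr_ge0.
have u0 : 0 <= upf f x c w l by [].
have l0 : 0 <= lowf f x c w l by [].
have [h1|h1] := leP (n%:R * lvar f * (1 - eta)) _; last first.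
  have -> : lowf f x c w l = 1 by rewrite /lowf (ltW h1).
  by move: u0 s0 => /=; lra.
have [h2|h2] := leP _ (n%:R * lvar f * (1 + eta)); last first.
  have -> : upf f x c w l = 1 by rewrite /upf (ltW h2).
  by move: l0 s0 => /=; lra.
rewrite /=; apply: (le_trans IH); rewrite lerD2l lerDr.
by rewrite addr_ge0.
Qed.

Lemma integral_tw c l : (\int[law]_x (tw (x jS) (x (jU c l)))%:E = 1)%E.
Proof.
have := @integral_tw_expR (LForm 0 0 0 0 0) 0 c ord0 l.
rewrite !mulr0 !mul0r addr0 => /(_ ltr01); rewrite ln1 mul0r mulr0 oppr0 expR0 => <-.
by apply: eq_integral => x _; rewrite mul0r oppr0 expR0 mulr1.
Qed.

(** The probability of the good event under the tilted law, whose density [tw] has mass one by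
    [integral_tw]. *)
Let Eg c w l := (\int[law]_x (tw (x jS) (x (jU c l)) * (gd x c w l)%:R)%:E)%E.

Lemma Eg_ge0 c w l : (0 <= Eg c w l)%E.
Proof. by apply: integral_ge0 => x _; rewrite lee_fin mulr_ge0 ?tw_ge0. Qed.

Lemma Eg_le1 c w l : (Eg c w l <= 1)%E.
Proof.
rewrite -(integral_tw c l); apply: ge0_le_integral => //.
- by move=> x _; rewrite lee_fin mulr_ge0 ?tw_ge0.
- apply/measurable_EFinP; apply: measurable_funM; first exact: measurable_tw_entry.
  exact: measurable_gd.
- by apply/measurable_EFinP; exact: measurable_tw_entry.
- by move=> x _; rewrite lee_fin ler_piMr ?tw_ge0// lern1 leq_b1.
Qed.

Lemma Eg_ge c w l : (1 <= Eg c w l + (16 * expR (- (n%:R * kappa)))%:E)%E.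
Proof.
have mtw := @measurable_tw_entry c l.
have mup f := measurable_upf f c w l.
have mlow f := measurable_lowf f c w l.
have up0 f (x : X) : 0 <= tw (x jS) (x (jU c l)) * upf f x c w l.
  by rewrite mulr_ge0 ?tw_ge0.
have low0 f (x : X) : 0 <= tw (x jS) (x (jU c l)) * lowf f x c w l.
  by rewrite mulr_ge0 ?tw_ge0.
rewrite -[leLHS](integral_tw c l).
apply: (@le_trans _ _ (\int[law]_x ((tw (x jS) (x (jU c l)) * (gd x c w l)%:R)%:E +
  \sum_(f <- forms) ((tw (x jS) (x (jU c l)) * upf f x c w l)%:E +
      (tw (x jS) (x (jU c l)) * lowf f x c w l)%:E)))%E).
  apply: ge0_le_integral => //.
  - by move=> x _; rewrite lee_fin tw_ge0.
  - exact/measurable_EFinP.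
  - apply: emeasurable_funD.
      by apply/measurable_EFinP; apply: measurable_funM => //; exact: measurable_gd.
    apply: emeasurable_sum => f; apply: emeasurable_funD;
      by apply/measurable_EFinP; exact: measurable_funM.
  - move=> x _; rewrite sumEFin -EFinD lee_fin.
    rewrite (_ : \sum_(f <- forms) _ = tw (x jS) (x (jU c l)) *
      \sum_(f <- forms) (upf f x c w l + lowf f x c w l)); last first.
      by rewrite mulr_sumr; apply: eq_bigr => f _; rewrite mulrDr.
    rewrite -mulrDr -[leLHS]mulr1 ler_wpM2l ?tw_ge0//; exact: good_cover.
rewrite ge0_integralD//=; last 4 first.
- by move=> x _; rewrite lee_fin mulr_ge0 ?tw_ge0.
- by apply/measurable_EFinP; apply: measurable_funM => //; exact: measurable_gd.
- by move=> x _; apply: sume_ge0 => f _; rewrite adde_ge0// lee_fin.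
- apply: emeasurable_sum => f; apply: emeasurable_funD;
    by apply/measurable_EFinP; exact: measurable_funM.
apply: leeD => //.
rewrite ge0_integral_sum//; last 2 first.
- by move=> f; apply: emeasurable_funD;
    by apply/measurable_EFinP; exact: measurable_funM.
- by move=> f x _; rewrite adde_ge0// lee_fin.
pose ex := expR (- (n%:R * kappa)).
suff H (s : seq lform) : all (fun f => 0 < lvar f) s ->
    (\sum_(f <- s) \int[law]_x ((tw (x jS) (x (jU c l)) * upf f x c w l)%:E +
      (tw (x jS) (x (jU c l)) * lowf f x c w l)%:E) <=
     ((size s)%:R * (2 * ex))%:E)%E.
  (* The constant 16 is eight forms times two tails. *)
  apply: (le_trans (H _ all_lvar_gt0)); rewrite lee_fin /= -/ex; lra.
elim: s => [|f s IH /= /andP[f0 sP]]; first by rewrite big_nil mul0r.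
rewrite big_cons -natr1 mulrDl mul1r EFinD [leRHS]addeC; apply: leeD; last exact: IH.
rewrite ge0_integralD//; last 4 first.
- by move=> x _; rewrite lee_fin.
- by apply/measurable_EFinP; exact: measurable_funM.
- by move=> x _; rewrite lee_fin.
- by apply/measurable_EFinP; exact: measurable_funM.
rewrite [leRHS](_ : _ = (ex%:E + ex%:E)%E); last by rewrite -EFinD; congr EFin; ring.
by apply: leeD; [exact: chernoff_up|exact: chernoff_low].
Qed.

(** * Bounds valid on the good event *)

Lemma sqnE (y z : vec) : (forall i, y i = z i) -> sqn y = sqn z.
Proof. by move=> h; apply: eq_bigr => i _; rewrite h. Qed.

Definition bounded (v x : R) := n%:R * v * (1 - eta) <= x <= n%:R * v * (1 + eta).

Lemma goodP V X U S Z : good V X U S Z ->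
  [/\ bounded (su ^+ 2) (sqn U),
      bounded (sg ^+ 2) (sqn (fun i => U i - al * k * S i)),
      bounded e (sqn (lin (LForm 0 0 (k * (1 - al)) (1 - be) 1) V X U S Z)),
      bounded (a ^+ 2 + b ^+ 2) (sqn (fun i => a * V i + b * X i)) &
      bounded (cc ^+ 2 + r ^+ 2 * sQ ^+ 2 + sg ^+ 2)
        (sqn (fun i => cc * V i + r * S i + (U i - al * k * S i)))] /\
  [/\ bounded (e + s1) (sqn (lin (LForm 0 b (k * (1 - al)) (1 - be) 1) V X U S Z)),
      bounded (e + s2) (sqn (lin (LForm 0 b (k * (1 - al)) 1 1) V X U S Z)) &
      bounded (e + s3) (sqn (lin (LForm ka b (k * (1 - al)) 1 1) V X U S Z))].
Proof.
have [v1 v2 v3 v4 v5 v6 v7 v8] := lvar_forms.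
rewrite /good /= v1 v2 v3 v4 v5 v6 v7 v8 -!/(bounded _ _).
case/and5P => b1 b2 b3 b4 /and5P[b5 b6 b7 b8 _]; split; split => //.
- by rewrite (@sqnE _ (lin (LForm 0 0 0 1 0) V X U S Z))// => i; rewrite /lin/=; ring.
- rewrite (@sqnE _ (lin (LForm 0 0 (- (al * k)) 1 0) V X U S Z))// => i.
  by rewrite /lin/=; ring.
- by rewrite (@sqnE _ (lin (LForm a b 0 0 0) V X U S Z))// => i; rewrite /lin/=; ring.
- rewrite (@sqnE _ (lin (LForm cc 0 (r - al * k) 1 0) V X U S Z))// => i.
  by rewrite /lin/=; ring.
Qed.

(** The main exponent ln(su^2/sg^2)/2 is I(U;S). The two quadratic terms of [twE] are n/2 up to n
    eta/2 each, so their difference is at most n eta. *)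
Lemma good_tw V X U S Z : good V X U S Z ->
  tw S U <= expR (n%:R * (ln (su ^+ 2 / sg ^+ 2) / 2 + eta)).
Proof.
move=> /goodP[[/andP[_ h1] /andP[h2 _] _ _ _] _]; rewrite twE ler_expR [leRHS]mulrDr lerD2l.
have su2 : 0 < su ^+ 2 by rewrite exprn_gt0.
have sg2 : 0 < sg ^+ 2 by rewrite exprn_gt0.
have {}h1 : sqn U / su ^+ 2 <= n%:R * (1 + eta) by rewrite ler_pdivrMr// mulrAC.
have {}h2 : n%:R * (1 - eta) <= sqn (fun i => U i - al * k * S i) / sg ^+ 2.
  by rewrite ler_pdivlMr// mulrAC.
by move: h1 h2; lra.
Qed.

(** With [h] equal to 1/(2e), the quadratic exponents of the averaged competitor and of the sent
    codeword are both n/2 up to n eta/2. They cancel, and only the determinant factor survives. *)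
Lemma gweight_le (s x y : R) : 0 <= s -> bounded e x -> bounded (e + s) y ->
  expR (- (n%:R * (ln (1 + 2 * (2 * e)^-1 * s) / 2)) -
    (2 * e)^-1 / (1 + 2 * (2 * e)^-1 * s) * y) / expR (- ((2 * e)^-1 * x)) <=
  expR (- (n%:R * (ln (1 + s / e) / 2 - eta))).
Proof.
move=> s0 /andP[_ hx] /andP[hy _].
have es0 : 0 < e + s by rewrite ltr_wpDr.
rewrite (_ : 1 + 2 * (2 * e)^-1 * s = 1 + s / e); last by field; rewrite gt_eqF.
rewrite -expRN -expRD ler_expR.
rewrite (_ : (2 * e)^-1 / (1 + s / e) = (2 * (e + s))^-1); last first.
  by field; rewrite !gt_eqF.
have {}hx : x / e <= n%:R * (1 + eta) by rewrite ler_pdivrMr// mulrAC.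
have {}hy : n%:R * (1 - eta) <= y / (e + s) by rewrite ler_pdivlMr// mulrAC.
rewrite !invfM; move: hx hy.
rewrite (_ : 2^-1 / e * x = x / e / 2); last by field; rewrite gt_eqF.
rewrite (_ : 2^-1 / (e + s) * y = y / (e + s) / 2); last by field; rewrite gt_eqF.
lra.
Qed.

(** * Likelihood weights and competing codewords *)

Let h0 := (2 * e)^-1.

(** The unnormalized density, at the residual, of a Gaussian noise of variance [e]; written with
    [gweight] so that competing codewords can be integrated out by [integral_gweight]. *)
Definition vw (y V X U : vec) : R :=
  gweight h0 0 (fun i => y i + - ka * V i + - be * U i + - b * X i).

Lemma vw_gt0 y V X U : 0 < vw y V X U.
Proof. exact: expR_gt0. Qed.

Lemma measurable_vw (d : measure_display) (T : measurableType d)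
    (y V X U : T -> vec) : mvec y -> mvec V -> mvec X -> mvec U ->
  measurable_fun setT (fun t => vw (y t) (V t) (X t) (U t)).
Proof.
move=> my mV mX mU; rewrite /vw.
under eq_fun do rewrite gweight0.
apply: measurableT_comp => //; apply: measurableT_comp => //.
apply: measurable_funM => //; apply: measurable_sqn => i.
by do !apply: measurable_funD => //; apply: measurable_funM.
Qed.

Definition ylin (V X U S Z : vec) : vec :=
  lin (LForm ka b (k * (1 - al)) 1 1) V X U S Z.

(** Multiplied by the weight [vw] of a competitor, this is the tilted density on the good event
    times the likelihood ratio of the competitor to the sent codeword. *)
Definition lratio (V X U S Z : vec) : R :=
  tw S U * (good V X U S Z)%:R / vw (ylin V X U S Z) V X U.

Lemma lratio_ge0 V X U S Z : 0 <= lratio V X U S Z.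
Proof. by rewrite divr_ge0 ?mulr_ge0 ?tw_ge0// ltW// vw_gt0. Qed.

Let yl (x : X) c w l : vec :=
  ylin (x (jV c)) (x (jX c w)) (x (jU c l)) (x jS) (x jZ).
Let lr (x : X) c w l : R :=
  lratio (x (jV c)) (x (jX c w)) (x (jU c l)) (x jS) (x jZ).

Lemma mvec_yl c w l : mvec (fun x : X => yl x c w l).
Proof. by apply: mvec_lin; exact: mvec_coord. Qed.

Lemma measurable_lr c w l : measurable_fun setT (fun x : X => lr x c w l).
Proof.
apply: measurable_funM.
  apply: measurable_funM; first exact: measurable_tw_entry.
  exact: measurable_gd.
apply: measurable_fun_inv_gt0; first by move=> x; exact: vw_gt0.
by apply: measurable_vw; [exact: mvec_yl| | |]; exact: mvec_coord.
Qed.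

Lemma yl_update j (x : X) u c w l :
  j != jV c -> j != jX c w -> j != jU c l -> j != jS -> j != jZ ->
  yl (update x j u) c w l = yl x c w l.
Proof.
rewrite !(eq_sym j) => h1 h2 h3 h4 h5.
by rewrite /yl (update_neq _ _ h1) (update_neq _ _ h2) (update_neq _ _ h3)
  (update_neq _ _ h4) (update_neq _ _ h5).
Qed.

Lemma lr_update j (x : X) u c w l :
  j != jV c -> j != jX c w -> j != jU c l -> j != jS -> j != jZ ->
  lr (update x j u) c w l = lr x c w l.
Proof.
rewrite !(eq_sym j) => h1 h2 h3 h4 h5.
by rewrite /lr (update_neq _ _ h1) (update_neq _ _ h2) (update_neq _ _ h3)
  (update_neq _ _ h4) (update_neq _ _ h5).
Qed.

Lemma integral_lr_le (s : R) (y : X -> vec) c w l : 0 <= s -> mvec y ->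
  (forall x, gd x c w l -> bounded (e + s) (sqn (y x))) ->
  (\int[law]_x (lr x c w l * gweight h0 s (y x))%:E <=
   (expR (- (n%:R * (ln (1 + s / e) / 2 - eta))))%:E * Eg c w l)%E.
Proof.
move=> s0 my yb.
have mtg : measurable_fun setT
    (fun x : X => tw (x jS) (x (jU c l)) * (gd x c w l)%:R).
  by apply: measurable_funM; [exact: measurable_tw_entry|exact: measurable_gd].
rewrite /Eg -ge0_integralZl//; last 2 first.
- exact/measurable_EFinP.
- by move=> x _; rewrite lee_fin mulr_ge0 ?tw_ge0.
apply: ge0_le_integral => //.
- by move=> x _; rewrite lee_fin mulr_ge0 ?lratio_ge0 ?gweight_ge0.
- apply/measurable_EFinP; apply: measurable_funM; first exact: measurable_lr.
  exact: measurable_gweight.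
- by apply: emeasurable_funM => //; exact/measurable_EFinP.
move=> x _; rewrite -EFinM lee_fin /lr /lratio -/(gd x c w l).
have [G|_] := boolP (gd x c w l); last by rewrite mulr0 !mul0r mulr0.
rewrite mulr1 mulrAC -mulrA [leRHS]mulrC ler_wpM2l ?tw_ge0//.
have [[_ _ xb _ _] _] := goodP G.
rewrite /vw gweight0.
rewrite (@sqnE (fun i => yl x c w l i + - ka * x (jV c) i + - be * x (jU c l) i +
   - b * x (jX c w) i) (lf (LForm 0 0 (k * (1 - al)) (1 - be) 1) x c w l)).
  exact: gweight_le s0 xb (yb _ G).
by move=> i; rewrite /yl /ylin /lf /lin /=; ring.
Qed.

Let bs1 := expR (- (n%:R * (ln (1 + s1 / e) / 2 - eta))).
Let bs2 := expR (- (n%:R * (ln (1 + s2 / e) / 2 - eta))).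
Let bs3 := expR (- (n%:R * (ln (1 + s3 / e) / 2 - eta))).

Lemma h0_gt0 : 0 < h0. Proof. by rewrite invr_gt0 mulr_gt0. Qed.

Lemma posD s : 0 <= s -> 0 < 1 + 2 * h0 * s.
Proof. by move=> s0; rewrite ltr_wpDr// !mulr_ge0// ltW// h0_gt0. Qed.

Lemma s1_ge0 : 0 <= s1. Proof. exact: sqr_ge0. Qed.

Lemma s2_ge0 : 0 <= s2.
Proof. exact: addr_ge0 (sqr_ge0 _) (mulr_ge0 (sqr_ge0 _) (sqr_ge0 _)). Qed.

Lemma s3_ge0 : 0 <= s3.
Proof. exact: addr_ge0 s2_ge0 (sqr_ge0 _). Qed.

Let vx (x : X) (y : vec) c w l := vw y (x (jV c)) (x (jX c w)) (x (jU c l)).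

(** A competing codeword occurs neither in the factor of the sent index nor in the output, so it is
    a plain independent Gaussian: only the sent index carries a tilt. *)
Lemma cross_X (y : X -> vec) (K : X -> R) c w l :
  mvec y -> measurable_fun setT K -> (forall x, 0 <= K x) ->
  (forall x u, K (update x (jX c w) u) = K x) ->
  (forall x u, y (update x (jX c w) u) = y x) ->
  (\int[law]_x (K x * vx x (y x) c w l)%:E =
   \int[law]_x (K x * gweight h0 s1
     (fun i => y x i + - ka * x (jV c) i + - be * x (jU c l) i))%:E)%E.
Proof.
move=> my mK K0 Kj yj.
have s1E : 0 + (- b) ^+ 2 * sdev (jX c w) ^+ 2 = s1.
  by rewrite /s1 /=; ring.
have my' i : measurable_fun setT
    (fun x : X => y x i + - ka * x (jV c) i + - be * x (jU c l) i).
  by do !apply: measurable_funD => //; apply: measurable_funM => //;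
    exact: measurable_entry.
have yj' x u : (fun i => y (update x (jX c w) u) i +
    - ka * update x (jX c w) u (jV c) i + - be * update x (jX c w) u (jU c l) i) =
    (fun i => y x i + - ka * x (jV c) i + - be * x (jU c l) i).
  by rewrite yj !update_neq.
have p1 : 0 < 1 + 2 * h0 * (0 + (- b) ^+ 2 * sdev (jX c w) ^+ 2).
  by rewrite s1E; exact: posD s1_ge0.
rewrite -s1E.
exact: (integral_gweight (sdev_neq0 _) mK K0 Kj my' yj' (posD (lexx 0)) p1).
Qed.

Lemma cross_U (y : X -> vec) (K : X -> R) c l :
  mvec y -> measurable_fun setT K -> (forall x, 0 <= K x) ->
  (forall x u, K (update x (jU c l) u) = K x) ->
  (forall x u, y (update x (jU c l) u) = y x) ->
  (\int[law]_x (K x * gweight h0 s1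
     (fun i => y x i + - ka * x (jV c) i + - be * x (jU c l) i))%:E =
   \int[law]_x (K x * gweight h0 s2 (fun i => y x i + - ka * x (jV c) i))%:E)%E.
Proof.
move=> my mK K0 Kj yj.
have s2E : s1 + (- be) ^+ 2 * sdev (jU c l) ^+ 2 = s2.
  by rewrite /s1 /s2 /=; ring.
have my' i : measurable_fun setT (fun x : X => y x i + - ka * x (jV c) i).
  by apply: measurable_funD => //; apply: measurable_funM => //;
    exact: measurable_entry.
have yj' x u : (fun i => y (update x (jU c l) u) i +
    - ka * update x (jU c l) u (jV c) i) =
    (fun i => y x i + - ka * x (jV c) i).
  by rewrite yj !update_neq.
have p1 : 0 < 1 + 2 * h0 * (s1 + (- be) ^+ 2 * sdev (jU c l) ^+ 2).
  by rewrite s2E; exact: posD s2_ge0.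
rewrite -[in RHS]s2E.
exact: (integral_gweight (sdev_neq0 _) mK K0 Kj my' yj' (posD s1_ge0) p1).
Qed.

Lemma cross_V (y : X -> vec) (K : X -> R) c :
  mvec y -> measurable_fun setT K -> (forall x, 0 <= K x) ->
  (forall x u, K (update x (jV c) u) = K x) ->
  (forall x u, y (update x (jV c) u) = y x) ->
  (\int[law]_x (K x * gweight h0 s2 (fun i => y x i + - ka * x (jV c) i))%:E =
   \int[law]_x (K x * gweight h0 s3 (y x))%:E)%E.
Proof.
move=> my mK K0 Kj yj.
have s3E : s2 + (- ka) ^+ 2 * sdev (jV c) ^+ 2 = s3.
  by rewrite /s3 /s2 /=; ring.
have p1 : 0 < 1 + 2 * h0 * (s2 + (- ka) ^+ 2 * sdev (jV c) ^+ 2).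
  by rewrite s3E; exact: posD s3_ge0.
rewrite -[in RHS]s3E.
exact: (integral_gweight (sdev_neq0 _) mK K0 Kj my yj (posD s2_ge0) p1).
Qed.

(** A wrong message always has a fresh X. If the common message is wrong, U and V are fresh too; if
    it is right, V is the sent one and U is fresh exactly when the index differs. *)
Let crossb c l (c' : 'I_mc.+1) (l' : 'I_ll.+1) : R :=
  if c' != c then bs3 else if l' != l then bs2 else bs1.

Lemma cross_le c w l c' w' l' : (c', w') != (c, w) ->
  (\int[law]_x (lr x c w l * vx x (yl x c w l) c' w' l')%:E <=
   (crossb c l c' l')%:E * Eg c w l)%E.
Proof.
move=> ne.
have mlr := @measurable_lr c w l.
have lr0 (x : X) : 0 <= lr x c w l by exact: lratio_ge0.
have myl := @mvec_yl c w l.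
have neX : jX c' w' != jX c w by apply: contra_neq ne => -[-> ->].
rewrite cross_X//; last 2 first.
- by move=> x u; rewrite lr_update.
- by move=> x u; rewrite yl_update.
rewrite /crossb; have [cc'|cc'] /= := eqVneq c' c; last first.
  have neU : jU c' l' != jU c l by apply: contra_neq cc' => -[].
  have neV : jV c' != jV c by apply: contra_neq cc' => -[].
  rewrite cross_U//; last 2 first.
  - by move=> x u; rewrite lr_update.
  - by move=> x u; rewrite yl_update.
  rewrite cross_V//; last 2 first.
  - by move=> x u; rewrite lr_update.
  - by move=> x u; rewrite yl_update.
  apply: integral_lr_le => //; first exact: s3_ge0.
  by move=> x /goodP[_ []].
subst c'.
have mcoord j i : measurable_fun setT (fun x : X => x j i).
  exact: measurable_entry.
have [ll'|ll'] /= := eqVneq l' l; last first.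
  have neU : jU c l' != jU c l by apply: contra_neq ll' => -[].
  rewrite cross_U//; last 2 first.
  - by move=> x u; rewrite lr_update.
  - by move=> x u; rewrite yl_update.
  apply: integral_lr_le; first exact: s2_ge0.
    by move=> i; apply: measurable_funD => //; exact: measurable_funM.
  move=> x /goodP[_ [_ + _]].
  rewrite (@sqnE _ (fun i => yl x c w l i + - ka * x (jV c) i))// => i.
  by rewrite /yl /ylin /lin /=; ring.
subst l'.
apply: integral_lr_le; first exact: s1_ge0.
  by move=> i; do !apply: measurable_funD => //; exact: measurable_funM.
move=> x /goodP[_ [+ _ _]].
rewrite (@sqnE _ (fun i => yl x c w l i + - ka * x (jV c) i + - be * x (jU c l) i))// => i.
by rewrite /yl /ylin /lin /=; ring.
Qed.

(** Given the state, the likelihood ratio of an independent codeword has mean one. *)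
Lemma tw_cross c w l l' : l' != l ->
  (\int[law]_x (tw (x jS) (x (jU c l)) * (gd x c w l)%:R *
     tw (x jS) (x (jU c l')))%:E = Eg c w l)%E.
Proof.
move=> ll'.
have neU : jU c l' != jU c l by apply: contra_neq ll' => -[].
pose K (x : X) := tw (x jS) (x (jU c l)) * (gd x c w l)%:R.
have mK : measurable_fun setT K.
  by apply: measurable_funM; [exact: measurable_tw_entry|exact: measurable_gd].
have Kj x u : K (update x (jU c l') u) = K x.
  rewrite eq_sym in neU.
  rewrite /K /gd (update_neq _ _ neU).
  by do !rewrite update_neq//.
transitivity (\int[law]_x (K x * ((\prod_i tilt su sg (al * k * x jS i) (x (jU c l') i)) *
    gweight 0 0 (fun i => 0 + 0 * x (jU c l') i)))%:E)%E.
  apply: eq_integral => x _; congr (_ * _)%:E.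
  by rewrite gweight0 mul0r oppr0 expR0 mulr1.
rewrite (@integral_gweight_tilt _ _ _ sdev (jU c l') su sg 0 0 K
  (fun x i => al * k * x jS i) (fun _ _ => 0))//.
- apply: eq_integral => x _; rewrite /gweight.
  by rewrite !(mulr0, mul0r, addr0, ln1, oppr0, expR0, mulr1).
- by move=> x; rewrite mulr_ge0 ?tw_ge0.
- by move=> i; apply: measurable_funM => //; exact: measurable_entry.
- by rewrite mulr0 mul0r addr0.
Qed.

(** * Encoders, decoder and the soft error *)

Definition msg := ('I_mc.+1 * 'I_m1.+1)%type.

(** All indices of the bin count for the message: mistaking the index alone is not an error. *)
Definition Dm (x : X) (m : msg) (y : vec) : R :=
  \sum_(l < ll.+1) vx x y m.1 m.2 l.

(** The default is harmless: by [decx_correct], a wrong output means that the sent message carries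
    at most half of the total weight. *)
Definition decx (x : X) (y : vec) : msg :=
  odflt (ord0, ord0)
    [pick m | [ffun m : msg => \sum_m' Dm x m' y < 2 * Dm x m y] m].

Lemma Dm_gt0 x m y : 0 < Dm x m y.
Proof.
rewrite /Dm big_ord_recl ltr_pwDl ?vw_gt0//.
by apply: sumr_ge0 => l _; rewrite ltW// vw_gt0.
Qed.

Lemma sum_Dm x m y : \sum_m' Dm x m' y = Dm x m y + \sum_(m' | m' != m) Dm x m' y.
Proof. by rewrite (bigD1 m). Qed.

Lemma decx_correct x m y : \sum_m' Dm x m' y < 2 * Dm x m y -> decx x y = m.
Proof.
move=> Dm2; rewrite /decx; case: pickP => [m'|/(_ m)]; rewrite ffunE; last first.
  by rewrite Dm2.
move=> Dm'2 /=; apply/eqP/negPn/negP => m'm.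
have : Dm x m y + Dm x m' y <= \sum_m' Dm x m' y.
  rewrite (sum_Dm x m) lerD2l (bigD1 m')//= lerDl.
  by apply: sumr_ge0 => *; rewrite ltW// Dm_gt0.
by move: Dm2 Dm'2; lra.
Qed.

Definition raw1 (x : X) c w : vec := fun i => a * x (jV c) i + b * x (jX c w) i.

Definition raw2 (x : X) c l (S : vec) : vec :=
  fun i => cc * x (jV c) i + r * S i + (x (jU c l) i - al * k * S i).

(** A codeword that is too long is replaced by silence, so the power constraint holds for every
    codebook; on the good event nothing is cut, by [out_good]. *)
Definition enc1x (x : X) c w : vec :=
  fun i => if sqn (raw1 x c w) <= n%:R * P1 then raw1 x c w i else 0.

Definition enc2x (x : X) c l (S : vec) : vec :=
  fun i => if sqn (raw2 x c l S) <= n%:R * P2 then raw2 x c l S i else 0.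

Definition outx (x : X) c w l (S Z : vec) : vec :=
  fun i => enc1x x c w i + enc2x x c l S i + S i + Z i.

Definition errx (x : X) c w l (S Z : vec) : bool :=
  decx x (outx x c w l S Z) != (c, w).

Lemma out_good (x : X) c w l : gd x c w l ->
  outx x c w l (x jS) (x jZ) = yl x c w l.
Proof.
move=> /goodP[[_ _ _ /andP[_ p1] /andP[_ p2]] _].
have n0 : 0 <= n%:R :> R by [].
have q1 : sqn (raw1 x c w) <= n%:R * P1.
  by apply: (le_trans p1); rewrite -mulrA ler_wpM2l.
have q2 : sqn (raw2 x c l (x jS)) <= n%:R * P2.
  by apply: (le_trans p2); rewrite -mulrA ler_wpM2l.
apply/funext => i; rewrite /outx /enc1x /enc2x q1 q2 /raw1 /raw2.
by rewrite /yl /ylin /lin /= /ka /k; ring.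
Qed.

Let twx (x : X) c l : R := tw (x jS) (x (jU c l)).
Let tws (x : X) c : R := \sum_(l < ll.+1) twx x c l.

Lemma tws_gt0 x c : 0 < tws x c.
Proof.
rewrite /tws big_ord_recl ltr_pwDl ?tw_gt0//.
by apply: sumr_ge0 => l _; rewrite ltW// tw_gt0.
Qed.

Definition softerr (x : X) c w : R :=
  \sum_(l < ll.+1) twx x c l / tws x c * (errx x c w l (x jS) (x jZ))%:R.

Lemma softerr_ge0 x c w : 0 <= softerr x c w.
Proof.
apply: sumr_ge0 => l _; rewrite mulr_ge0// divr_ge0 ?tw_ge0//.
by rewrite ltW// tws_gt0.
Qed.

Let Lr : R := ll.+1%:R.

Let lrsum (x : X) c w l : R :=
  \sum_(m : msg | m != (c, w)) \sum_(l' < ll.+1)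
    lr x c w l * vx x (yl x c w l) m.1 m.2 l'.

(** For a good index the error indicator is at most [2 * (1 - d)], where [d] is the share of weight
    of the sent message, and [likelihood_tangent] bounds [d] times the selection probability from
    below. For the other indices the indicator is at most one. The term with [6 / Lr] stays on the
    left so that both sides are nonnegative and can be integrated. *)
Lemma softerr_le (x : X) c w :
  softerr x c w + 6 / Lr * \sum_(l < ll.+1) twx x c l * (gd x c w l)%:R <=
  2 + 2 / Lr * \sum_(l < ll.+1) (twx x c l * (gd x c w l)%:R * tws x c / Lr +
     (twx x c l * (gd x c w l)%:R + lrsum x c w l)).
Proof.
have L0 : 0 < Lr by rewrite ltr0n.
have t0 := tws_gt0 x c.
have sum2 : 2 = \sum_(l < ll.+1) 2 * (twx x c l / tws x c) :> R.
  by rewrite -mulr_sumr -mulr_suml divff ?mulr1// gt_eqF.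
rewrite [X in _ <= X + _]sum2 {sum2}.
rewrite !mulr_sumr -!big_split /=; apply: ler_sum => l _.
have w0 : 0 < twx x c l by exact: tw_gt0.
have e0' : 0 <= twx x c l / tws x c by rewrite divr_ge0 ?ltW.
have [G|G] := boolP (gd x c w l); last first.
  have -> : lrsum x c w l = 0.
    rewrite /lrsum; apply: big1 => m _; apply: big1 => l' _.
    by rewrite /lr /lratio -/(gd x c w l) (negbTE G) mulr0 !mul0r.
  rewrite !(mulr0, mul0r, addr0).
  have : ((errx x c w l (x jS) (x jZ))%:R : R) <= 1 by rewrite lern1 leq_b1.
  by nra.
rewrite !mulr1 /errx out_good//.
set y := yl x c w l.
pose v := vx x y c w l.
have v0 : 0 < v by exact: vw_gt0.
pose Y := \sum_(m' | m' != (c, w)) Dm x m' y.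
have Y0 : 0 <= Y by apply: sumr_ge0 => m _; rewrite ltW// Dm_gt0.
have D0 := Dm_gt0 x (c, w) y.
have lrsE : lrsum x c w l = twx x c l * (Y / v).
  rewrite /lrsum /Y mulr_suml mulr_sumr; apply: eq_bigr => m _.
  rewrite /Dm mulr_suml mulr_sumr; apply: eq_bigr => l' _.
  rewrite /lr /lratio -/(gd x c w l) G mulr1 -/y -[vw _ _ _ _]/v.
  by rewrite mulrAC mulrA.
pose d := Dm x (c, w) y / (Dm x (c, w) y + Y).
have vD : v <= Dm x (c, w) y.
  rewrite /Dm (bigD1 l)//= lerDl; apply: sumr_ge0 => *.
  by rewrite ltW// vw_gt0.
have dv : v / (v + Y) <= d.
  rewrite /d ler_pdivrMr ?ltr_wpDr// mulrAC ler_pdivlMr ?ltr_wpDr//.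
  by nra.
(* The two competing totals are the weight of the other indices in the bin and the weight [Y] of all
   other messages. *)
have := @likelihood_tangent _ Lr (twx x c l) v (tws x c - twx x c l) Y d L0 w0 v0.
rewrite (addrC (twx x c l) (_ - _)) subrK => /(_ _ Y0 dv).
have Xge : 0 <= tws x c - twx x c l.
  rewrite subr_ge0 /tws (bigD1 l)//= lerDl; apply: sumr_ge0 => *.
  by rewrite ltW// tw_gt0.
move=> /(_ Xge) tan.
have er : ((decx x y != (c, w))%:R : R) <= 2 * (1 - d).
  have [|ne] := eqVneq (decx x y) (c, w).
    by rewrite /= mulr_ge0// subr_ge0 /d ler_pdivrMr ?ltr_wpDr// mul1r lerDl.
  have : ~~ (\sum_m' Dm x m' y < 2 * Dm x (c, w) y).
    by apply: contra ne => /decx_correct ->.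
  rewrite -leNgt (sum_Dm x (c, w)) -/Y /= => le2.
  have : d <= 2^-1 by rewrite /d ler_pdivrMr ?ltr_wpDr//; lra.
  by lra.
rewrite lrsE.
set E := twx x c l / tws x c in tan e0' *.
have {}er : E * (decx x y != (c, w))%:R <= E * (2 * (1 - d)) by rewrite ler_wpM2l.
have -> : 2 / Lr * (twx x c l * tws x c / Lr + (twx x c l + twx x c l * (Y / v))) =
  2 * (twx x c l / Lr * (tws x c / Lr + (v + Y) / v)).
  by field; rewrite !gt_eqF.
have -> : 6 / Lr * twx x c l = 2 * (3 * (twx x c l / Lr)) by field; rewrite gt_eqF.
have Ed : E * (2 * (1 - d)) = 2 * E - 2 * (E * d) by ring.
move: er tan; rewrite Ed; clearbody E; move: (twx x c l / Lr) (twx x c l / Lr * _).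
move: (E * d) (E * _%:R) => t1 t2 t3 t4; lra.
Qed.

(** * Mean error over the random codebook *)

Lemma measurable_errx (d : measure_display) (T : measurableType d)
    (x : T -> X) (S Z : T -> vec) c w l :
  (forall j, mvec (fun t => x t j)) -> mvec S -> mvec Z ->
  measurable_fun setT (fun t => errx (x t) c w l (S t) (Z t)).
Proof.
move=> mx mS mZ.
have mr1 : mvec (fun t => raw1 (x t) c w).
  by move=> i; apply: measurable_funD; apply: measurable_funM => //; exact: mx.
have mr2 : mvec (fun t => raw2 (x t) c l (S t)).
  move=> i; apply: measurable_funD.
    by apply: measurable_funD; apply: measurable_funM => //; exact: mx.
  by apply: measurable_funB; [exact: mx|exact: measurable_funM].
have mout : mvec (fun t => outx (x t) c w l (S t) (Z t)).
  move=> i; do !apply: measurable_funD => //; apply: measurable_fun_ifT => //.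
  - by apply: measurable_fun_ler => //; exact: measurable_sqn.
  - by apply: measurable_fun_ler => //; exact: measurable_sqn.
have mD m : measurable_fun setT (fun t => Dm (x t) m (outx (x t) c w l (S t) (Z t))).
  by apply: measurable_sum => l'; apply: measurable_vw => //; exact: mx.
rewrite /errx /decx.
apply: (@measurable_fun_ffun _ _ msg
  (fun m t => \sum_m' Dm (x t) m' (outx (x t) c w l (S t) (Z t)) <
     2 * Dm (x t) m (outx (x t) c w l (S t) (Z t)))
  (fun phi => odflt (ord0, ord0) [pick m | phi m] != (c, w))) => m.
apply: measurable_fun_ltr; first exact: measurable_sum.
exact: measurable_funM.
Qed.

Lemma measurable_twx c l : measurable_fun setT (fun x : X => twx x c l).
Proof. exact: measurable_tw_entry. Qed.

Lemma measurable_softerr c w : measurable_fun setT (fun x : X => softerr x c w).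
Proof.
apply: measurable_sum => l; apply: measurable_funM.
  apply: measurable_funM; first exact: measurable_twx.
  apply: measurable_fun_inv_gt0; first by move=> x; exact: tws_gt0.
  by apply: measurable_sum => l'; exact: measurable_twx.
by apply: measurable_fun_natr; apply: measurable_errx => *; exact: mvec_coord.
Qed.

Lemma measurable_vx (y : X -> vec) c w l : mvec y ->
  measurable_fun setT (fun x : X => vx x (y x) c w l).
Proof. by move=> my; apply: measurable_vw => //; exact: mvec_coord. Qed.

Lemma measurable_lrsum c w l : measurable_fun setT (fun x : X => lrsum x c w l).
Proof.
have -> : (fun x : X => lrsum x c w l) = (fun x : X =>
    \sum_(m : msg) (m != (c, w))%:R * \sum_(l' < ll.+1)
      lr x c w l * vx x (yl x c w l) m.1 m.2 l').
  apply/funext => x; rewrite /lrsum big_mkcond/=; apply: eq_bigr => m _.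
  by case: ifP; rewrite ?mul1r ?mul0r.
apply: measurable_sum => m; apply: measurable_funM => //.
apply: measurable_sum => l'; apply: measurable_funM; first exact: measurable_lr.
by apply: measurable_vx; exact: mvec_yl.
Qed.

Lemma ge0_integral_sumEFin (I : Type) (s : seq I) (P : pred I) (f : I -> X -> R) :
  (forall i, measurable_fun setT (f i)) -> (forall i x, 0 <= f i x) ->
  (\int[law]_x (\sum_(i <- s | P i) f i x)%:E =
   \sum_(i <- s | P i) \int[law]_x (f i x)%:E)%E.
Proof.
move=> mf f0; under eq_integral do rewrite -sumEFin -big_filter.
rewrite ge0_integral_sum//; first by rewrite big_filter.
- by move=> i; exact/measurable_EFinP.
- by move=> i x _; rewrite lee_fin.
Qed.

(** The covering defect: small once the bin size exceeds exp(n(I(U;S) + eta)). *)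
Let del1 := expR (n%:R * (ln (su ^+ 2 / sg ^+ 2) / 2 + eta)) / Lr.

Lemma measurable_twgd c w l :
  measurable_fun setT (fun x : X => twx x c l * (gd x c w l)%:R).
Proof.
by apply: measurable_funM; [exact: measurable_twx|exact: measurable_gd].
Qed.

(** Each index other than [l] contributes [Eg] by [tw_cross], the index [l] itself at most the bound
    of [good_tw] times [Eg]; the division by [Lr] gives [1 + del1]. *)
Lemma tws_term c w l :
  (\int[law]_x (twx x c l * (gd x c w l)%:R * tws x c / Lr)%:E <=
   (1 + del1)%:E * Eg c w l)%E.
Proof.
have L0 : 0 < Lr by rewrite ltr0n.
pose ex := expR (n%:R * (ln (su ^+ 2 / sg ^+ 2) / 2 + eta)).
have t0 x l' : 0 <= twx x c l' by exact: tw_ge0.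
have mt l' : measurable_fun setT (fun x : X => twx x c l * (gd x c w l)%:R * twx x c l').
  by apply: measurable_funM; [exact: measurable_twgd|exact: measurable_twx].
have -> : (\int[law]_x (twx x c l * (gd x c w l)%:R * tws x c / Lr)%:E =
    (Lr^-1)%:E * \sum_(l' < ll.+1) \int[law]_x
      (twx x c l * (gd x c w l)%:R * twx x c l')%:E)%E.
  rewrite -ge0_integral_sumEFin//; last by move=> l' x; rewrite !mulr_ge0.
  rewrite -ge0_integralZl//; last 3 first.
  - by apply/measurable_EFinP; exact: measurable_sum.
  - by move=> x _; rewrite lee_fin; apply: sumr_ge0 => l' _; rewrite !mulr_ge0.
  - by rewrite lee_fin invr_ge0 ltW.
  apply: eq_integral => x _; rewrite -EFinM; congr EFin.
  by rewrite /tws -mulr_sumr mulrC.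
have step l' : (\int[law]_x (twx x c l * (gd x c w l)%:R * twx x c l')%:E <=
    (if l' == l then ex else 1)%:E * Eg c w l)%E.
  have [->|l'l] := eqVneq l' l; last by rewrite tw_cross// mul1e.
  rewrite /Eg -ge0_integralZl//; last 3 first.
  - by apply/measurable_EFinP; exact: measurable_twgd.
  - by move=> x _; rewrite lee_fin mulr_ge0 ?tw_ge0.
  - by rewrite lee_fin expR_ge0.
  apply: ge0_le_integral => //.
  - by move=> x _; rewrite lee_fin !mulr_ge0.
  - exact/measurable_EFinP.
  - by apply: emeasurable_funM => //; apply/measurable_EFinP; exact: measurable_twgd.
  - move=> x _; rewrite -EFinM lee_fin mulrC.
    have [G|_] := boolP (gd x c w l); last by rewrite !mulr0.
    by rewrite !mulr1 ler_wpM2r//; exact: good_tw G.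
apply: (@le_trans _ _ ((Lr^-1)%:E * \sum_(l' < ll.+1)
    ((if l' == l then ex else 1)%:E * Eg c w l))%E).
  by rewrite lee_pmul2l ?lte_fin ?invr_gt0//; apply: lee_sum => l' _; exact: step.
rewrite -ge0_sume_distrl; last first.
  by move=> l' _; rewrite lee_fin; case: ifP => // _; exact: expR_ge0.
rewrite muleA; apply: lee_wpmul2r; first exact: Eg_ge0.
rewrite sumEFin -EFinM lee_fin /del1 -/ex mulrC.
rewrite (_ : 1 + ex / Lr = (Lr + ex) / Lr); last by field; rewrite gt_eqF.
apply: ler_wpM2r; first by rewrite invr_ge0 ltW.
rewrite (bigD1 l)//= eqxx [leLHS]addrC lerD2r.
apply: (@le_trans _ _ (\sum_(i < ll.+1) 1)).
  rewrite [leRHS](bigD1 l)//= -[leLHS]add0r lerD//.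
  by apply: ler_sum => i /negbTE ->.
by rewrite sumr_const card_ord.
Qed.

Let Mcr : R := mc.+1%:R.
Let M1r : R := m1.+1%:R.
(** The packing defect: a union bound over competitors that differ in X only, in X and U, or in all
    three components, with their numbers as coefficients. *)
Let del2 := M1r * bs1 + M1r * Lr * bs2 + Mcr * M1r * Lr * bs3.

Lemma lrsum_term c w l :
  (\int[law]_x (lrsum x c w l)%:E <= del2%:E * Eg c w l)%E.
Proof.
have lr0 (x : X) : 0 <= lr x c w l by exact: lratio_ge0.
have vx0 (x : X) y m l' : 0 <= vx x y m.1 m.2 l' by rewrite ltW// vw_gt0.
have mt (m : msg) l' : measurable_fun setT
    (fun x : X => lr x c w l * vx x (yl x c w l) m.1 m.2 l').
  apply: measurable_funM; first exact: measurable_lr.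
  by apply: measurable_vx; exact: mvec_yl.
rewrite /lrsum ge0_integral_sumEFin; last 2 first.
- by move=> m; exact: measurable_sum.
- by move=> m x; apply: sumr_ge0 => l' _; rewrite mulr_ge0.
have cb0 c' l' : 0 <= crossb c l c' l'.
  by rewrite /crossb; do 2?[case: ifP => _]; exact: expR_ge0.
apply: (@le_trans _ _ (\sum_(m : msg | m != (c, w)) \sum_(l' < ll.+1)
   ((crossb c l m.1 l')%:E * Eg c w l))%E).
  apply: lee_sum => -[c' w'] /= ne; rewrite ge0_integral_sumEFin; last 2 first.
  - by move=> l'; exact: (mt (c', w')).
  - by move=> l' x; rewrite mulr_ge0// ltW// vw_gt0.
  by apply: lee_sum => l' _; exact: cross_le.
under eq_bigr => m _.
  rewrite -ge0_sume_distrl; last by move=> l' _; rewrite lee_fin.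
  rewrite sumEFin; over.
rewrite -ge0_sume_distrl; last first.
  by move=> m _; rewrite lee_fin; apply: sumr_ge0 => l' _; exact: cb0.
rewrite sumEFin; apply: lee_wpmul2r; first exact: Eg_ge0.
rewrite lee_fin.
have b10 : 0 <= bs1 by exact: expR_ge0.
have b20 : 0 <= bs2 by exact: expR_ge0.
have b30 : 0 <= bs3 by exact: expR_ge0.
(* Overcounting, each case also paying for the more general ones, makes the double sum easy to
   evaluate. *)
pose bd (c' : 'I_mc.+1) (l' : 'I_ll.+1) : R :=
  bs3 + (c' == c)%:R * (bs2 + (l' == l)%:R * bs1).
have bd0 c' l' : 0 <= bd c' l' by rewrite addr_ge0 ?mulr_ge0 ?addr_ge0 ?mulr_ge0.
apply: (@le_trans _ _ (\sum_(m : msg) \sum_(l' < ll.+1) bd m.1 l')).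
  rewrite [leRHS](bigD1 (c, w))//= -[leLHS]add0r lerD//.
    by apply: sumr_ge0 => l' _; exact: bd0.
  apply: ler_sum => m _; apply: ler_sum => l' _.
  rewrite /crossb /bd; case: eqP => _ /=; last by rewrite mul0r addr0.
  by case: eqP => _ /=; rewrite ?mul1r ?mul0r; lra.
have sl c' : \sum_(l' < ll.+1) bd c' l' = Lr * bs3 + (c' == c)%:R * (Lr * bs2 + bs1).
  rewrite /bd big_split /= sumr_const card_ord -[bs3 *+ _]mulr_natl; congr (_ + _).
  rewrite -mulr_sumr big_split /= sumr_const card_ord -[bs2 *+ _]mulr_natl.
  congr (_ * (_ + _)); rewrite -mulr_suml (bigD1 l)//= eqxx big1 ?addr0 ?mul1r//.
  by move=> i /negbTE ->.
under eq_bigr do rewrite sl.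
rewrite big_split /= sumr_const card_prod !card_ord -mulr_suml.
have -> : \sum_(m : msg) (m.1 == c)%:R = M1r.
  rewrite -(pair_bigA _ (fun c' w' => (c' == c)%:R : R)) /=.
  rewrite (bigD1 c)//= [X in _ + X]big1 ?addr0.
    by rewrite eqxx sumr_const card_ord.
  by move=> i /negbTE ->; rewrite big1.
rewrite -[_ *+ _]mulr_natl natrM /del2 -/Mcr -/M1r.
by rewrite le_eqVlt; apply/orP; left; apply/eqP; ring.
Qed.

(** After integration the good probability [g] has coefficient 6 on the left and 2(2 + del1 + del2)
    on the right. What remains is 2(1 - g) + 2(del1 + del2)g, and [Eg_ge] turns the first term into
    the constant 32. *)
Lemma integral_softerr_le c w :
  (\int[law]_x (softerr x c w)%:E <=
   (32 * expR (- (n%:R * kappa)) + 2 * (del1 + del2))%:E)%E.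
Proof.
have L0 : 0 < Lr by rewrite ltr0n.
have L6 : 0 <= 6 / Lr by rewrite divr_ge0// ltW.
have L2 : 0 <= 2 / Lr by rewrite divr_ge0// ltW.
have t0 x l' : 0 <= twx x c l' by exact: tw_ge0.
have tws0 x : 0 <= tws x c by rewrite ltW// tws_gt0.
have lrs0 x l : 0 <= lrsum x c w l.
  apply: sumr_ge0 => m _; apply: sumr_ge0 => l' _.
  by rewrite mulr_ge0 ?lratio_ge0// ltW// vw_gt0.
pose g l := fine (Eg c w l).
have gE l : Eg c w l = (g l)%:E.
  rewrite fineK// ge0_fin_numE ?Eg_ge0//.
  by rewrite (le_lt_trans (Eg_le1 _ _ _))// ltry.
have g1 l : g l <= 1 by rewrite -lee_fin -gE Eg_le1.
have g2 l : 1 <= g l + 16 * expR (- (n%:R * kappa)).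
  by rewrite -lee_fin EFinD -gE Eg_ge.
have mtg l := measurable_twgd c w l.
have mtt l : measurable_fun setT
    (fun x : X => twx x c l * (gd x c w l)%:R * tws x c / Lr).
  apply: measurable_funM => //; apply: measurable_funM => //.
  by apply: measurable_sum => l'; exact: measurable_twx.
have mls l := measurable_lrsum c w l.
have msum l : measurable_fun setT
    (fun x : X => twx x c l * (gd x c w l)%:R * tws x c / Lr +
     (twx x c l * (gd x c w l)%:R + lrsum x c w l)).
  by apply: measurable_funD => //; exact: measurable_funD.
have sum0 l x : 0 <= twx x c l * (gd x c w l)%:R * tws x c / Lr +
     (twx x c l * (gd x c w l)%:R + lrsum x c w l).
  by rewrite !addr_ge0 ?mulr_ge0 ?invr_ge0// ltW.
have : (\int[law]_x ((softerr x c w)%:E + ((6 / Lr)%:E *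
      (\sum_(l < ll.+1) twx x c l * (gd x c w l)%:R)%:E)) <=
    \int[law]_x (2%:E + (2 / Lr)%:E *
      (\sum_(l < ll.+1) (twx x c l * (gd x c w l)%:R * tws x c / Lr +
     (twx x c l * (gd x c w l)%:R + lrsum x c w l)))%:E))%E.
  apply: ge0_le_integral => //.
  - move=> x _; rewrite -EFinM -EFinD lee_fin addr_ge0 ?softerr_ge0//.
    by rewrite mulr_ge0//; apply: sumr_ge0 => l _; rewrite mulr_ge0.
  - apply: emeasurable_funD.
      by apply/measurable_EFinP; exact: measurable_softerr.
    by apply: emeasurable_funM => //; apply/measurable_EFinP; exact: measurable_sum.
  - apply: emeasurable_funD => //.
    by apply: emeasurable_funM => //; apply/measurable_EFinP; exact: measurable_sum.
  - by move=> x _; rewrite -!EFinM -!EFinD lee_fin; exact: softerr_le.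
have twg0 l (x : X) : 0 <= twx x c l * (gd x c w l)%:R by rewrite mulr_ge0.
rewrite ge0_integralD//=; last 4 first.
- by move=> x _; rewrite lee_fin softerr_ge0.
- by apply/measurable_EFinP; exact: measurable_softerr.
- by move=> x _; rewrite -EFinM lee_fin mulr_ge0//; apply: sumr_ge0.
- by apply: emeasurable_funM => //; apply/measurable_EFinP; exact: measurable_sum.
rewrite ge0_integralZl//; last 2 first.
- by apply/measurable_EFinP; exact: measurable_sum.
- by move=> x _; rewrite lee_fin; apply: sumr_ge0.
have gsum : (\int[law]_x (\sum_(l < ll.+1) twx x c l * (gd x c w l)%:R)%:E =
    (\sum_(l < ll.+1) g l)%:E)%E.
  rewrite ge0_integral_sumEFin// -sumEFin.
  by apply: eq_bigr => l _; rewrite -gE.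
rewrite gsum.
rewrite ge0_integralD//=; last 2 first.
- by move=> x _; rewrite -EFinM lee_fin mulr_ge0//; apply: sumr_ge0.
- by apply: emeasurable_funM => //; apply/measurable_EFinP; exact: measurable_sum.
have c2 : (\int[law]_x 2%:E = 2%:E)%E.
  by rewrite integral_cst//= probability_setT mule1.
rewrite c2 ge0_integralZl//; last 2 first.
- by apply/measurable_EFinP; exact: measurable_sum.
- by move=> x _; rewrite lee_fin; apply: sumr_ge0.
rewrite [X in (_ <= _ + _ * X)%E -> _]ge0_integral_sumEFin// => h.
have {h} : (\int[law]_x (softerr x c w)%:E + (6 / Lr * \sum_l g l)%:E <=
    (2 + 2 / Lr * \sum_l ((1 + del1) * g l + (g l + del2 * g l)))%:E)%E.
  rewrite EFinM; apply: (le_trans h); rewrite [leRHS]EFinD; apply: leeD => //.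
  rewrite [leRHS]EFinM.
  apply: lee_wpmul2l; first by rewrite lee_fin.
  rewrite -sumEFin; apply: lee_sum => l _.
  under eq_integral do rewrite EFinD EFinD.
  rewrite ge0_integralD//=; last 4 first.
  - by move=> x _; rewrite lee_fin !mulr_ge0 ?invr_ge0// ltW.
  - exact/measurable_EFinP.
  - by move=> x _; rewrite -EFinD lee_fin addr_ge0.
  - by apply: emeasurable_funD; exact/measurable_EFinP.
  rewrite ge0_integralD//=; last 4 first.
  - by move=> x _; rewrite lee_fin.
  - exact/measurable_EFinP.
  - by move=> x _; rewrite lee_fin.
  - exact/measurable_EFinP.
  rewrite !EFinD !EFinM -gE; apply: leeD; first exact: tws_term.
  by apply: leeD => //; exact: lrsum_term.
rewrite -leeBrDr// -EFinB => /le_trans; apply; rewrite lee_fin.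
have -> : 2 + 2 / Lr * \sum_l ((1 + del1) * g l + (g l + del2 * g l)) -
    6 / Lr * \sum_l g l = 2 + Lr^-1 * \sum_l (2 * (del1 + del2) - 2) * g l.
  rewrite -mulr_sumr (_ : \sum_l ((1 + del1) * g l + (g l + del2 * g l)) =
    (2 + del1 + del2) * \sum_l g l); first by field; rewrite gt_eqF.
  by rewrite mulr_sumr; apply: eq_bigr => l _; ring.
have d1 : 0 <= del1 by rewrite divr_ge0 ?expR_ge0// ltW.
have d2 : 0 <= del2 by rewrite !addr_ge0 ?mulr_ge0 ?expR_ge0.
pose TT := 2 * (del1 + del2) - 2 + 32 * expR (- (n%:R * kappa)).
have : \sum_(l < ll.+1) (2 * (del1 + del2) - 2) * g l <= Lr * TT.
  rewrite [leRHS]mulr_natl -[in leRHS](card_ord ll.+1) -sumr_const.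
  apply: ler_sum => l _; have := g1 l; have := g2 l.
  have : (del1 + del2) * g l <= (del1 + del2) * 1.
    by rewrite ler_wpM2l// addr_ge0.
  by rewrite /TT; move: (expR _) => ex; lra.
rewrite -(ler_pM2l (_ : 0 < Lr^-1)) ?invr_gt0// mulKf ?gt_eqF// /TT.
by move: (expR _) (Lr^-1 * _) => ex t; lra.
Qed.

(** * Fixing the codebook *)

Let bnd := 32 * expR (- (n%:R * kappa)) + 2 * (del1 + del2).
Let muS := gauss_vec n sQ.
Let muZ := gauss_vec n sN.
Let setSZ (x : X) (s z : vec) : X := update (update x jS s) jZ z.

Let fsum (x : X) : R := \sum_(c < mc.+1) \sum_(w < m1.+1) softerr x c w.

(** Resampling the coordinates [jS] and [jZ] separates state and noise from the codewords, so [x] is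
    fixed before they are drawn. All messages are summed first, so one codebook serves their
    average. *)
Lemma exists_codebook (B : R) : bnd < B -> exists x : X,
  (\int[muS]_s \int[muZ]_z (fsum (setSZ x s z))%:E < (Mcr * M1r * B)%:E)%E.
Proof.
move=> bB.
have M0 : 0 < Mcr * M1r by rewrite mulr_gt0// ltr0n.
have f0 x : 0 <= fsum x.
  by apply: sumr_ge0 => c _; apply: sumr_ge0 => w _; exact: softerr_ge0.
have mf : measurable_fun setT (fun x : X => (fsum x)%:E).
  apply/measurable_EFinP; apply: measurable_sum => c.
  by apply: measurable_sum => w; exact: measurable_softerr.
pose F1 (x : X) : \bar R := (\int[muZ]_z (fsum (update x jZ z))%:E)%E.
have F10 x : (0 <= F1 x)%E by apply: integral_ge0 => z _; rewrite lee_fin.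
have mF1 : measurable_fun setT F1.
  apply: (measurable_fun_fubini_tonelli_F
    (fun p : X * vec => (fsum (update_right jZ p))%:E)).
    exact: (measurableT_comp mf (measurable_update_right jZ)).
  by move=> p; rewrite lee_fin.
pose F2 (x : X) : \bar R := (\int[muS]_s F1 (update x jS s))%E.
have F20 x : (0 <= F2 x)%E by apply: integral_ge0.
have mF2 : measurable_fun setT F2.
  apply: (measurable_fun_fubini_tonelli_F
    (fun p : X * vec => F1 (update_right jS p))).
    exact: (measurableT_comp mF1 (measurable_update_right jS)).
  by move=> p; exact: F10.
have int2 : (\int[law]_x F2 x = \int[law]_x (fsum x)%:E)%E.
  have fE0 x : (0 <= (fsum x)%:E)%E by rewrite lee_fin.
  have h1 := ge0_integral_pprob_update (fun j => gauss_vec n (sdev j)) jZ mf fE0.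
  have h2 := ge0_integral_pprob_update (fun j => gauss_vec n (sdev j)) jS mF1 F10.
  exact: (esym (etrans h1 h2)).
apply: (@exists_lt_integral _ _ _ law F2) => //.
  rewrite mulr_ge0 ?(ltW M0)//; apply: ltW; apply: le_lt_trans bB.
  by rewrite -lee_fin; apply: (le_trans _ (integral_softerr_le ord0 ord0));
    apply: integral_ge0 => x _; rewrite lee_fin softerr_ge0.
rewrite int2; apply: (@le_lt_trans _ _ (Mcr * M1r * bnd)%:E); last first.
  by rewrite lte_fin ltr_pM2l.
rewrite ge0_integral_sumEFin; last 2 first.
- by move=> c; apply: measurable_sum => w; exact: measurable_softerr.
- by move=> c x; apply: sumr_ge0 => w _; exact: softerr_ge0.
rewrite [leRHS](_ : _ = (\sum_(c < mc.+1) \sum_(w < m1.+1) bnd%:E)%E); last first.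
  under eq_bigr do rewrite sumEFin.
  rewrite sumEFin; congr EFin.
  by rewrite !sumr_const !card_ord -mulrnA mulnC -mulr_natl natrM.
apply: lee_sum => c _; rewrite ge0_integral_sumEFin; last 2 first.
- by move=> w; exact: measurable_softerr.
- by move=> w x; exact: softerr_ge0.
by apply: lee_sum => w _; exact: integral_softerr_le.
Qed.

(** * Deterministic choice of the index *)

Section derandomization.
Variable x : X.

Let er c w l (s z : vec) : R := (errx x c w l s z)%:R.
Let ew c l (s : vec) : R :=
  tw s (x (jU c l)) / \sum_(l' < ll.+1) tw s (x (jU c l')).

Lemma softerr_setSZ c w s z :
  softerr (setSZ x s z) c w = \sum_(l < ll.+1) ew c l s * er c w l s z.
Proof. by []. Qed.

Lemma mvec_fst : mvec (fun p : vec * vec => p.1).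
Proof.
by move=> i; apply: (@measurable_coord_comp _ _ _ _ _ fst); exact: measurable_fst.
Qed.

Lemma mvec_snd : mvec (fun p : vec * vec => p.2).
Proof.
by move=> i; apply: (@measurable_coord_comp _ _ _ _ _ snd); exact: measurable_snd.
Qed.

Lemma measurable_er2 c w l :
  measurable_fun setT (fun p : vec * vec => errx x c w l p.1 p.2).
Proof.
apply: (@measurable_errx _ (vec * vec)%type (fun=> x)).
- by move=> j i; exact: measurable_cst.
- exact: mvec_fst.
- exact: mvec_snd.
Qed.

Lemma measurable_erz c w l s : measurable_fun setT (fun z : vec => er c w l s z).
Proof.
apply: measurable_fun_natr; apply: (@measurable_errx _ vec (fun=> x) (fun=> s)).
- by move=> j i; exact: measurable_cst.
- by move=> i; exact: measurable_cst.
- by move=> i; exact: measurable_coord.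
Qed.

Let pe c w l (s : vec) : \bar R := (\int[muZ]_z (er c w l s z)%:E)%E.

Lemma pe_ge0 c w l s : (0 <= pe c w l s)%E.
Proof. by apply: integral_ge0 => z _; rewrite lee_fin. Qed.

Lemma pe_fin c w l s : pe c w l s \is a fin_num.
Proof.
rewrite ge0_fin_numE ?pe_ge0//; apply: (@le_lt_trans _ _ 1%E); last exact: ltry.
have <- : (\int[muZ]_z 1%:E = 1)%E by rewrite integral_cst//= probability_setT mule1.
apply: ge0_le_integral => //.
- by move=> z _; rewrite lee_fin.
- by apply/measurable_EFinP; exact: measurable_erz.
- by move=> z _; rewrite lee_fin lern1 leq_b1.
Qed.

Lemma measurable_pe c w l : measurable_fun setT (pe c w l).
Proof.
apply: (measurable_fun_fubini_tonelli_F
  (fun p : vec * vec => (er c w l p.1 p.2)%:E)).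
  by apply/measurable_EFinP; apply: measurable_fun_natr; exact: measurable_er2.
by move=> p; rewrite lee_fin.
Qed.

(** The sum over [w] reflects that the informed encoder must choose its index without knowing the
    individual message. *)
Let pes c l (s : vec) : R := \sum_(w < m1.+1) fine (pe c w l s).

Lemma measurable_pes c l : measurable_fun setT (pes c l).
Proof.
apply: measurable_sum => w; apply: measurableT_comp; last exact: measurable_pe.
exact: (fine_measurable measurableT).
Qed.

(** A minimizer is read off the finite table of pairwise comparisons, which makes the choice
    measurable in the state. *)
Let best (phi : {ffun 'I_ll.+1 * 'I_ll.+1 -> bool}) : 'I_ll.+1 :=
  odflt ord0 [pick l | [forall l', phi (l, l')]].

Definition lstar c (s : vec) : 'I_ll.+1 :=
  best [ffun p => pes c p.1 s <= pes c p.2 s].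

Lemma lstar_le c s l : pes c (lstar c s) s <= pes c l s.
Proof.
rewrite /lstar /best; case: pickP => [l0 /forallP/(_ l)|no].
  by rewrite ffunE.
have [m _ mP] := @arg_minP _ _ _ (ord0 : 'I_ll.+1) predT (fun l => pes c l s) erefl.
move: (no m) => /negbT/negP; case.
by apply/forallP => l'; rewrite ffunE /=; exact: mP.
Qed.

Lemma measurable_lstar_err c w :
  measurable_fun setT (fun p : vec * vec => errx x c w (lstar c p.1) p.1 p.2).
Proof.
have mpes l : measurable_fun setT (fun p : vec * vec => pes c l p.1).
  by apply: measurableT_comp; [exact: measurable_pes|exact: measurable_fst].
have mb l : measurable_fun setT (fun p : vec * vec => lstar c p.1 == l).
  apply: (@measurable_fun_ffun _ (vec * vec)%type _
    (fun q p => pes c q.1 p.1 <= pes c q.2 p.1) (fun phi => best phi == l)) => q.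
  exact: measurable_fun_ler.
rewrite (_ : (fun p : vec * vec => _) = (fun p : vec * vec =>
   [exists l, [ffun l => (lstar c p.1 == l) && errx x c w l p.1 p.2] l])).
  apply: (@measurable_fun_ffun _ (vec * vec)%type _
    (fun l p => (lstar c p.1 == l) && errx x c w l p.1 p.2)
    (fun phi => [exists l, phi l])) => l.
  by apply: measurable_and => //; exact: measurable_er2.
apply/funext => p; apply/idP/existsP.
  by move=> h; exists (lstar c p.1); rewrite ffunE eqxx.
by move=> [l]; rewrite ffunE => /andP[/eqP ->].
Qed.

(** For each state, a minimum over the indices is at most their average with the weights [ew]. *)
Lemma sum_lstar_le c :
  (\sum_(w < m1.+1) \int[muS]_s pe c w (lstar c s) s <=
   \sum_(w < m1.+1) \int[muS]_s \int[muZ]_z (softerr (setSZ x s z) c w)%:E)%E.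
Proof.
have tw0 s : 0 < \sum_(l' < ll.+1) tw s (x (jU c l')).
  rewrite big_ord_recl ltr_pwDl ?tw_gt0//.
  by apply: sumr_ge0 => l _; exact: tw_ge0.
have ew0 l s : 0 <= ew c l s by rewrite divr_ge0 ?tw_ge0// ltW.
have ew1 s : \sum_(l < ll.+1) ew c l s = 1.
  by rewrite -mulr_suml divff// gt_eqF.
have mtw l : measurable_fun setT (fun s : vec => tw s (x (jU c l))).
  apply: (@measurable_tw _ vec id (fun=> x (jU c l))).
    by move=> i; exact: measurable_coord.
  by move=> i; exact: measurable_cst.
have mew l : measurable_fun setT (fun s : vec => ew c l s).
  apply: measurable_funM => //; apply: measurable_fun_inv_gt0 => //.
  exact: measurable_sum.
have mer w l s := measurable_erz c w l s.
have softE w s : (\int[muZ]_z (softerr (setSZ x s z) c w)%:E =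
    (\sum_(l < ll.+1) ew c l s * fine (pe c w l s))%:E)%E.
  under eq_integral do rewrite softerr_setSZ -sumEFin.
  rewrite ge0_integral_sum//; last 2 first.
  - by move=> l; apply/measurable_EFinP; exact: measurable_funM.
  - by move=> l z _; rewrite lee_fin mulr_ge0.
  rewrite -sumEFin; apply: eq_bigr => l _; rewrite EFinM fineK ?pe_fin//.
  under eq_integral do rewrite EFinM.
  rewrite ge0_integralZl//; first exact/measurable_EFinP.
  - by move=> z _; rewrite lee_fin.
  - by rewrite lee_fin.
have mpe w l : measurable_fun setT (fun s => fine (pe c w l s)).
  by apply: measurableT_comp; [exact: (fine_measurable measurableT)|exact: measurable_pe].
have fpe0 w l s : 0 <= fine (pe c w l s) by rewrite fine_ge0 ?pe_ge0.
have mlstar w : measurable_fun setT (fun s => pe c w (lstar c s) s).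
  apply: (measurable_fun_fubini_tonelli_F
    (fun p : vec * vec => (er c w (lstar c p.1) p.1 p.2)%:E)).
    by apply/measurable_EFinP; apply: measurable_fun_natr; exact: measurable_lstar_err.
  by move=> p; rewrite lee_fin.
pose B w s := (\sum_(l < ll.+1) ew c l s * fine (pe c w l s))%:E.
have A0 w s : (0 <= pe c w (lstar c s) s)%E by exact: pe_ge0.
have B0 w s : (0 <= B w s)%E.
  by rewrite lee_fin; apply: sumr_ge0 => l _; rewrite mulr_ge0.
have mB w : measurable_fun setT (B w).
  by apply/measurable_EFinP; apply: measurable_sum => l; exact: measurable_funM.
have intA : (\sum_(w < m1.+1) \int[muS]_s pe c w (lstar c s) s =
    \int[muS]_s \sum_(w < m1.+1) pe c w (lstar c s) s)%E.
  by apply/esym/ge0_integral_sum => // w s _; exact: A0.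
have intB : (\sum_(w < m1.+1) \int[muS]_s B w s = \int[muS]_s \sum_(w < m1.+1) B w s)%E.
  by apply/esym/ge0_integral_sum => // w s _; exact: B0.
have softB : (\sum_(w < m1.+1) \int[muS]_s \int[muZ]_z (softerr (setSZ x s z) c w)%:E =
    \sum_(w < m1.+1) \int[muS]_s B w s)%E.
  by apply: eq_bigr => w _; apply: eq_integral => s _; exact: softE.
rewrite softB intB intA.
apply: ge0_le_integral => //.
- by move=> s _; apply: sume_ge0 => w _; exact: A0.
- by apply: emeasurable_sum => w; exact: mlstar.
- by apply: emeasurable_sum => w; exact: mB.
move=> s _; rewrite /B sumEFin exchange_big /=.
have -> : (\sum_(w < m1.+1) pe c w (lstar c s) s =
    (pes c (lstar c s) s)%:E)%E.
  rewrite /pes -sumEFin; apply: eq_bigr => w _.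
  exact: (esym (fineK (pe_fin c w (lstar c s) s))).
rewrite lee_fin -[leLHS]mul1r -(ew1 s) mulr_suml; apply: ler_sum => l _.
rewrite -mulr_sumr; apply: (ler_wpM2l (ew0 l s)); exact: lstar_le.
Qed.

End derandomization.

Lemma exists_good_code (d : measure_display) (T : measurableType d)
    (P : probability T R) (S Z : nat -> {RV P >-> R}) (Q N B : R) :
  sQ = Num.sqrt Q -> sN = Num.sqrt N -> gauss_state_noise Q N S Z -> bnd < B ->
  exists c : Defs.code n mc.+1 m1.+1, [/\ power_ok P1 P2 c,
    (forall wc w1, measurable (err_event S Z c wc w1)) & err_prob S Z c <= B].
Proof.
move=> sQE sNE law_SZ bB; have [x xB] := exists_codebook bB.
pose cd : Defs.code n mc.+1 m1.+1 := @Defs.Code R n mc.+1 m1.+1 (enc1x x)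
  (fun c s => enc2x x c (lstar x c s) s) (decx x).
have evE wc w1 : err_event S Z cd wc w1 = state_noise S Z @^-1`
    [set p | errx x wc w1 (lstar x wc p.1) p.1 p.2] by [].
have mev wc w1 : measurable [set p : vec * vec | errx x wc w1 (lstar x wc p.1) p.1 p.2].
  rewrite [X in measurable X](_ : _ = setT `&`
    (fun p : vec * vec => errx x wc w1 (lstar x wc p.1) p.1 p.2) @^-1` [set true]).
    by apply: measurable_lstar_err.
  by rewrite setTI.
exists cd; split.
- have n0 : 0 <= n%:R :> R by [].
  have e1 : 0 <= 1 + eta by rewrite addr_ge0// ltW.
  have P10 : 0 <= P1.
    by apply: le_trans P1E; rewrite mulr_ge0// addr_ge0 ?sqr_ge0.
  have P20 : 0 <= P2.
    apply: le_trans P2E; rewrite mulr_ge0// !addr_ge0 ?sqr_ge0//.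
    by rewrite mulr_ge0 ?sqr_ge0.
  split => [wc w1|wc s] /=.
    rewrite /enc1x; case: (boolP (sqn (raw1 x wc w1) <= n%:R * P1)) => [//|_].
    by rewrite big1 ?mulr_ge0// => i _; rewrite expr0n.
  rewrite /enc2x.
  case: (boolP (sqn (raw2 x wc (lstar x wc s) s) <= n%:R * P2)) => [//|_].
  by rewrite big1 ?mulr_ge0// => i _; rewrite expr0n.
- move=> wc w1; rewrite evE -[X in measurable X]setTI.
  by apply: measurable_state_noise.
have fubR (g : vec * vec -> R) : measurable_fun setT g -> (forall p, 0 <= g p) ->
    (\int[muS]_s \int[muZ]_z (g (s, z))%:E = \int[muS \x muZ]_p (g p)%:E)%E.
  move=> mg g0; apply: esym; apply: fubini_tonelli1; first exact/measurable_EFinP.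
  by move=> p; rewrite lee_fin.
have memE (q : vec * vec -> bool) p : (p \in [set p | q p]) = q p.
  by apply/idP/idP => [/set_mem|h]; [|exact: mem_set].
have PE wc w1 : P (err_event S Z cd wc w1) = (\int[muS]_s \int[muZ]_z
    ((errx x wc w1 (lstar x wc s) s z)%:R : R)%:E)%E.
  rewrite evE (state_noise_law law_SZ (mev wc w1)) -sQE -sNE.
  have mn := @measurable_fun_natr R _ _ _ (@measurable_lstar_err x wc w1).
  rewrite (fubR (fun p => (errx x wc w1 (lstar x wc p.1) p.1 p.2)%:R) mn)//.
  have := @integral_indic _ (vec * vec)%type R (muS \x muZ)%E setT measurableT _ (mev wc w1).
  rewrite setIT => <-; apply: eq_integral => p _; rewrite indicE.
  by rewrite (memE (fun p => errx x wc w1 (lstar x wc p.1) p.1 p.2)).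
have msoft c w : measurable_fun setT (fun p : vec * vec => softerr (setSZ x p.1 p.2) c w).
  apply: (measurableT_comp (@measurable_softerr c w)).
  apply: measurable_pspace => j; rewrite /setSZ /update.
  case: (j == jZ); first exact: measurable_snd.
  by case: (j == jS); [exact: measurable_fst|exact: measurable_cst].
have soft0 c w (p : vec * vec) : 0 <= softerr (setSZ x p.1 p.2) c w by exact: softerr_ge0.
have fsumE : (\int[muS]_s \int[muZ]_z (fsum (setSZ x s z))%:E =
    \sum_(c < mc.+1) \sum_(w < m1.+1)
      \int[muS]_s \int[muZ]_z (softerr (setSZ x s z) c w)%:E)%E.
  transitivity (\int[muS \x muZ]_p (fsum (setSZ x p.1 p.2))%:E)%E.
    apply: (fubR (fun p => fsum (setSZ x p.1 p.2))).
      by apply: measurable_sum => c; apply: measurable_sum => w; exact: msoft.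
    by move=> p; apply: sumr_ge0 => c _; apply: sumr_ge0 => w _; exact: soft0.
  under eq_integral do rewrite -sumEFin.
  rewrite ge0_integral_sum; last 3 first.
  - exact: measurableT.
  - by move=> c; apply/measurable_EFinP; exact: measurable_sum.
  - by move=> c p _; rewrite lee_fin; apply: sumr_ge0.
  apply: eq_bigr => c _; under eq_integral do rewrite -sumEFin.
  rewrite ge0_integral_sum; last 3 first.
  - exact: measurableT.
  - by move=> w; exact/measurable_EFinP.
  - by move=> w p _; rewrite lee_fin.
  apply: eq_bigr => w _; apply: esym.
  exact: (fubR (fun p => softerr (setSZ x p.1 p.2) c w) (msoft c w) (soft0 c w)).
have M0 : 0 < Mcr * M1r by rewrite mulr_gt0// ltr0n.
rewrite /err_prob natrM -/Mcr -/M1r mulrC ler_pdivrMr// [leRHS]mulrC.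
rewrite -lee_fin; apply: le_trans (ltW xB); rewrite fsumE -sumEFin.
apply: lee_sum => c _; apply: le_trans (@sum_lstar_le x c).
rewrite -sumEFin; apply: lee_sum => w _.
by rewrite fineK ?fin_num_measure// -?PE//; rewrite evE -[X in measurable X]setTI;
  apply: measurable_state_noise.
Qed.

End random_coding.

(** * Rates *)

Section achievability.
Context {R : realType}.

(** Used with a successor, which puts the number of messages between exp(n rate) and, for
    nonnegative rates, twice that. *)
Definition nmsg (rate : R) (n : nat) : nat := Num.truncn (expR (n%:R * rate)).

Lemma nmsg_ge rate n : expR (n%:R * rate) <= (nmsg rate n).+1%:R.
Proof. exact/ltW/truncnS_gt. Qed.

Lemma nmsg_le rate n : 0 <= rate -> (nmsg rate n).+1%:R <= 2 * expR (n%:R * rate).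
Proof.
move=> r0; rewrite -natr1.
have h : (nmsg rate n)%:R <= expR (n%:R * rate) by rewrite truncn_le expR_ge0.
have : 1 <= expR (n%:R * rate) by rewrite -[leLHS]expR0 ler_expR mulr_ge0.
by move: h; lra.
Qed.

Lemma expR_decay (x c : R) n : x <= - c -> expR (n%:R * x) <= expR (- (n%:R * c)).
Proof. by move=> xc; rewrite ler_expR -mulrN ler_wpM2l. Qed.

Lemma cvg_expR_decay (c : R) : 0 < c ->
  (fun n : nat => expR (- (n%:R * c))) @ \oo --> (0 : R).
Proof.
move=> c0; rewrite (_ : (fun n => _) = (fun n : nat => expR (- c) ^+ n)).
  by apply: cvg_expr; rewrite ger0_norm ?expR_ge0// -expR0 ltr_expR oppr_lt0.
by apply/funext => n; rewrite -expRM_natl mulrN.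
Qed.

Lemma achievable_of_params (d : measure_display) (T : measurableType d)
    (P : probability T R) (S Z : nat -> {RV P >-> R}) (Q N P1 P2 : R)
    (a b cc r al be e su sg Rc R1 : R) :
  0 < Q -> 0 < N -> gauss_state_noise Q N S Z ->
  0 < su -> 0 < sg -> 0 < e -> b != 0 ->
  su ^+ 2 = (al * (1 + r)) ^+ 2 * Q + sg ^+ 2 ->
  ((1 + r) * (1 - al) + (1 - be) * (al * (1 + r))) ^+ 2 * Q +
    (1 - be) ^+ 2 * sg ^+ 2 + N = e ->
  e + be ^+ 2 * su ^+ 2 = (1 + r) ^+ 2 * Q + sg ^+ 2 + N ->
  a ^+ 2 + b ^+ 2 < P1 -> cc ^+ 2 + r ^+ 2 * Q + sg ^+ 2 < P2 ->
  0 <= Rc -> 0 <= R1 ->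
  R1 < ln (1 + b ^+ 2 / e) / 2 ->
  R1 + ln (su ^+ 2 / sg ^+ 2) / 2 <
    ln (1 + (b ^+ 2 + be ^+ 2 * su ^+ 2) / e) / 2 ->
  Rc + R1 + ln (su ^+ 2 / sg ^+ 2) / 2 <
    ln (1 + (b ^+ 2 + be ^+ 2 * su ^+ 2 + (a + cc) ^+ 2) / e) / 2 ->
  achievable P1 P2 S Z Rc R1.
Proof.
move=> Q0 N0 law_SZ su0 sg0 e0 b0 suE eE e2E p1 p2 Rc0 R10.
set I1 := ln (1 + b ^+ 2 / e) / 2.
set I0 := ln (su ^+ 2 / sg ^+ 2) / 2.
set I2 := ln (1 + (b ^+ 2 + be ^+ 2 * su ^+ 2) / e) / 2.
set I3 := ln (1 + (b ^+ 2 + be ^+ 2 * su ^+ 2 + (a + cc) ^+ 2) / e) / 2.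
move=> c1 c2 c3.
have v1 : 0 < a ^+ 2 + b ^+ 2 by rewrite ltr_wpDl ?sqr_ge0// exprn_even_gt0.
have v2 : 0 < cc ^+ 2 + r ^+ 2 * Q + sg ^+ 2.
  rewrite ltr_wpDl ?exprn_gt0// addr_ge0 ?sqr_ge0//.
  by rewrite mulr_ge0 ?sqr_ge0// ltW.
have I00 : 0 <= I0.
  rewrite divr_ge0// ln_ge0// ler_pdivlMr ?exprn_gt0// mul1r suE lerDr.
  by rewrite mulr_ge0 ?sqr_ge0// ltW.
(* In each rate condition one [eta] pays for the loss in the packing exponent and one is left as
   decay; the last two conditions need two more for the bin rate [RL]. *)
have [eta [eta0 p1E p2E c1E [c2E c3E]]] : exists eta, [/\ 0 < eta,
    (a ^+ 2 + b ^+ 2) * (1 + eta) <= P1,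
    (cc ^+ 2 + r ^+ 2 * Q + sg ^+ 2) * (1 + eta) <= P2,
    R1 + 2 * eta <= I1 & R1 + I0 + 4 * eta <= I2 /\ Rc + R1 + I0 + 4 * eta <= I3].
  pose t1 := (P1 - (a ^+ 2 + b ^+ 2)) / (a ^+ 2 + b ^+ 2).
  pose t2 := (P2 - (cc ^+ 2 + r ^+ 2 * Q + sg ^+ 2)) /
    (cc ^+ 2 + r ^+ 2 * Q + sg ^+ 2).
  have t10 : 0 < t1 by rewrite divr_gt0// subr_gt0.
  have t20 : 0 < t2 by rewrite divr_gt0// subr_gt0.
  pose t3 := (I1 - R1) / 2; pose t4 := (I2 - (R1 + I0)) / 4.
  pose t5 := (I3 - (Rc + R1 + I0)) / 4.
  have t30 : 0 < t3 by rewrite divr_gt0// subr_gt0.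
  have t40 : 0 < t4 by rewrite divr_gt0// subr_gt0.
  have t50 : 0 < t5 by rewrite divr_gt0// subr_gt0.
  pose t := Num.min t1 (Num.min t2 (Num.min t3 (Num.min t4 t5))).
  have : t <= t by [].
  rewrite {2}/t !le_min => /and5P[h1 h2 h3 h4 h5].
  exists t; split.
  - by rewrite /t !lt_min t10 t20 t30 t40 t50.
  - by move: h1; rewrite /t1 ler_pdivlMr//; lra.
  - by move: h2; rewrite /t2 ler_pdivlMr//; lra.
  - by move: h3; rewrite /t3; lra.
  - by split; [move: h4; rewrite /t4|move: h5; rewrite /t5]; lra.
(* One [eta] above the exponent in the covering defect, which therefore decays. *)
pose RL := I0 + 2 * eta.
have RL0 : 0 <= RL by rewrite addr_ge0// mulr_ge0// ltW.
pose kap := eta ^+ 2 / (4 * (2 + eta)).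
have kap0 : 0 < kap by rewrite divr_gt0 ?exprn_gt0// mulr_gt0// addr_gt0.
(* Here 30 is 2(1 + 2 + 4 + 8), from [d1] to [d4] below, and 33 instead of 32 makes the bound
   strict. *)
pose B n := 33 * expR (- (n%:R * kap)) + 30 * expR (- (n%:R * eta)).
have codeP n : exists c : Defs.code n (nmsg Rc n).+1 (nmsg R1 n).+1,
    [/\ power_ok P1 P2 c, (forall wc w1, measurable (err_event S Z c wc w1)) &
     err_prob S Z c <= B n].
  have sQ0 : 0 < Num.sqrt Q by rewrite sqrtr_gt0.
  have sN0 : 0 < Num.sqrt N by rewrite sqrtr_gt0.
  have sQ2 : Num.sqrt Q ^+ 2 = Q by rewrite sqr_sqrtr// ltW.
  have sN2 : Num.sqrt N ^+ 2 = N by rewrite sqr_sqrtr// ltW.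
  apply: (@exists_good_code R n (nmsg Rc n) (nmsg R1 n) (nmsg RL n)
    a b cc r al be e (Num.sqrt Q) (Num.sqrt N) su sg eta P1 P2) => //;
    rewrite ?sQ2 ?sN2//.
  set ML := (nmsg RL n).+1%:R; set MR := (nmsg R1 n).+1%:R; set MC := (nmsg Rc n).+1%:R.
  have mL : ML <= 2 * expR (n%:R * RL) by exact: nmsg_le.
  have mR : MR <= 2 * expR (n%:R * R1) by exact: nmsg_le.
  have mC : MC <= 2 * expR (n%:R * Rc) by exact: nmsg_le.
  have mL0 : 0 <= ML by [].
  have mR0 : 0 <= MR by [].
  have mC0 : 0 <= MC by [].
  set E := expR (- (n%:R * eta)).
  have d1 : expR (n%:R * (I0 + eta)) / ML <= E.
    rewrite ler_pdivrMr ?ltr0n//.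
    apply: (@le_trans _ _ (E * expR (n%:R * RL))).
      by rewrite -expRD ler_expR /RL; lra.
    by rewrite ler_wpM2l ?expR_ge0//; exact: nmsg_ge.
  have d2 : MR * expR (- (n%:R * (I1 - eta))) <= 2 * E.
    apply: (@le_trans _ _ (2 * expR (n%:R * R1) * expR (- (n%:R * (I1 - eta))))).
      by rewrite ler_wpM2r ?expR_ge0.
    rewrite -mulrA -expRD ler_wpM2l// -mulrN -mulrDr; apply: expR_decay; lra.
  have mRL : MR * ML <= 4 * expR (n%:R * (R1 + RL)).
    apply: (le_trans (ler_pM mR0 mL0 mR mL)); rewrite mulrACA -expRD -mulrDr.
    by rewrite -natrM.
  have d3 : MR * ML * expR (- (n%:R * (I2 - eta))) <= 4 * E.
    apply: (@le_trans _ _ (4 * expR (n%:R * (R1 + RL)) * expR (- (n%:R * (I2 - eta))))).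
      by rewrite ler_wpM2r ?expR_ge0.
    rewrite -mulrA -expRD ler_wpM2l// -mulrN -mulrDr; apply: expR_decay.
    by rewrite /RL; lra.
  have mCRL : MC * MR * ML <= 8 * expR (n%:R * (Rc + (R1 + RL))).
    rewrite -mulrA; apply: (le_trans (ler_pM mC0 (mulr_ge0 mR0 mL0) mC mRL)).
    by rewrite mulrACA -expRD -mulrDr -natrM.
  have d4 : MC * MR * ML * expR (- (n%:R * (I3 - eta))) <= 8 * E.
    apply: (@le_trans _ _ (8 * expR (n%:R * (Rc + (R1 + RL))) *
        expR (- (n%:R * (I3 - eta))))).
      by rewrite ler_wpM2r ?expR_ge0.
    rewrite -mulrA -expRD ler_wpM2l// -mulrN -mulrDr; apply: expR_decay.
    by rewrite /RL; lra.
  rewrite -/I1 -/I2 -/I3 -/I0 -/kap /B -/E.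
  have k0 : 0 < expR (- (n%:R * kap)) by exact: expR_gt0.
  move: d1 d2 d3 d4 k0.
  move: (expR (- (n%:R * kap))) (_ / ML) (MR * expR _) (MR * ML * _) (MC * MR * ML * _) => *.
  by lra.
pose c n := sval (cid (codeP n)).
have cP n := svalP (cid (codeP n)).
exists (fun n => (nmsg Rc n).+1), (fun n => (nmsg R1 n).+1), c; split.
  by move=> n; split; exact: nmsg_ge.
split; first by move=> n; case: (cP n).
split; first by move=> n; case: (cP n).
apply: (@squeeze_cvgr _ _ _ _ (fun=> 0) B).
- apply: nearW => n; have [_ _ ->] := cP n; rewrite andbT.
  rewrite /err_prob mulr_ge0 ?invr_ge0//; apply: sumr_ge0 => wc _.
  by apply: sumr_ge0 => w1 _; rewrite fine_ge0.
- exact: cvg_cst.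
- rewrite [X in _ --> X](_ : 0 = 33 * 0 + 30 * 0); last by rewrite !mulr0 addr0.
  by apply: cvgD; apply: cvgMr; exact: cvg_expR_decay.
Qed.

End achievability.

(** * From the region to the coding parameters *)

Section region.
Context {R : realType}.

Lemma lt_half_ln (x A B : R) : 0 < A -> 0 < B ->
  (x + ln A / 2 < ln B / 2) = (expR (2 * x) * A < B).
Proof.
move=> A0 B0; rewrite -[in RHS]ltr_ln ?posrE ?mulr_gt0 ?expR_gt0//.
rewrite lnM ?posrE ?expR_gt0// expRK.
by apply/idP/idP; lra.
Qed.

(* Minimum mean square estimation of [G + k S] from [U = al k S + G], where [Var
   (k S) = q] and [Var G = g]. *)
Lemma mmse_identities (g q al N k Q : R) : q = k ^+ 2 * Q -> g + al ^+ 2 * q != 0 ->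
  let D1 := g + al ^+ 2 * q in
  let be := (g + al * q) / D1 in
  let e := (g * q * (1 - al) ^+ 2 + N * D1) / D1 in
  (k * (1 - al) + (1 - be) * (al * k)) ^+ 2 * Q + (1 - be) ^+ 2 * g + N = e /\
  e + be ^+ 2 * D1 = k ^+ 2 * Q + g + N.
Proof.
move=> qE D10 D1 be e.
have beD : be * D1 = g + al * q by rewrite /be divfK.
have -> : (k * (1 - al) + (1 - be) * (al * k)) ^+ 2 * Q = q * (1 - al * be) ^+ 2.
  by rewrite qE; ring.
rewrite -qE; rewrite /e /be /D1; split; field; exact: D10.
Qed.

(** Strict inequalities between polynomials persist slightly to the left of 1. The three polynomials
    will be the rate conditions, cleared of denominators, as functions of the scaling of the
    amplitudes. *)
Lemma exists_shrink (p1 p2 p3 : {poly R}) :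
  0 < p1.[1] -> 0 < p2.[1] -> 0 < p3.[1] ->
  exists2 t : R, 0 < t < 1 & [/\ 0 < p1.[t], 0 < p2.[t] & 0 < p3.[t]].
Proof.
move=> h1 h2 h3.
have H (p : {poly R}) : 0 < p.[1] -> \forall t \near (1 : R)^'-, 0 < p.[t].
  move=> p0; apply: (cvgr_gt p.[1]) => //.
  by apply: cvg_at_left_filter; exact: continuous_horner.
have : \forall t \near (1 : R)^'-, (0 < t < 1) /\ [/\ 0 < p1.[t], 0 < p2.[t] & 0 < p3.[t]].
  near=> t; split.
    by apply/andP; split; near: t; [exact: nbhs_left_gt|exact: nbhs_left_lt].
  by split; near: t; exact: H.
by move=> /filter_ex[t [t01 ht]]; exists t.
Unshelve. all: by end_near. Qed.

End region.

Theorem theorem3 (R : realType) (d : measure_display) (T : measurableType d)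
  (P : probability T R) (S Z : nat -> {RV P >-> R}) (P1 P2 Q N : R) :
  0 < Q -> 0 < N -> 0 <= P1 -> 0 <= P2 ->
  gauss_state_noise Q N S Z ->
  inner_region P1 P2 Q N `<=` capacity_region P1 P2 S Z.
Proof.
move=> Q0 N0 P10 P20 law_SZ [Rc R1] /= [th [xi [rho [al]]]] /=.
set q := Qt Q P2 rho; set g := P2 * xi; set D1 := g + al ^+ 2 * q.
set D2 := g * q * (1 - al) ^+ 2 + N * D1.
move=> [/andP[th0 th1] /andP[xi0 xi1] /andP[rho1 rho0]].
move=> [D1n _ D2n D3n [_ _ _ A4ge [Rc0 R10 r1 r2 r3]]].
apply: subset_closure => /=.
have q0 : 0 <= q by exact: sqr_ge0.
(* For [g = 0] the argument of the last logarithm would be 0 instead of at least 1. *)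
have g0 : 0 < g.
  rewrite lt_neqAle eq_sym mulr_ge0// andbT; apply/eqP => gz.
  by move: A4ge; rewrite gz !mul0r ler10.
have P20' : 0 < P2.
  rewrite lt_neqAle P20 andbT; apply/eqP => Pz.
  by move: g0; rewrite /g -Pz mul0r ltxx.
have D10 : 0 < D1 by rewrite ltr_wpDr// mulr_ge0// sqr_ge0.
have D20 : 0 < D2.
  apply: ltr_wpDl; last exact: mulr_gt0.
  exact: mulr_ge0 (mulr_ge0 (ltW g0) q0) (sqr_ge0 _).
have D30 : 0 < g + q + N by rewrite addr_gt0// ltr_wpDr.
have E1E : N + g * q * (1 - al) ^+ 2 / D1 = D2 / D1.
  by rewrite /D2; field; rewrite gt_eqF.
set t1 := th * P1; rewrite E1E -/t1 in r1.
have t10 : 0 < t1.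
  rewrite lt_neqAle mulr_ge0// andbT; apply/eqP => tz.
  by move: r1; rewrite -tz mul0r addr0 ln1 mul0r ltNge R10.
have P10' : 0 < P1.
  rewrite lt_neqAle P10 andbT; apply/eqP => Pz.
  by move: t10; rewrite /t1 -Pz mulr0 ltxx.
have rho2 : rho ^+ 2 <= 1 - xi.
  rewrite -(sqr_sqrtr (_ : 0 <= 1 - xi)) ?subr_ge0//.
  by rewrite -sqrrN ler_pXn2r// ?nnegrE ?sqrtr_ge0//; lra.
set a0 := Num.sqrt ((1 - th) * P1) in r3.
set c0 := Num.sqrt (1 - xi - rho ^+ 2) * Num.sqrt P2 in r3.
have a2 : a0 ^+ 2 = (1 - th) * P1.
  by rewrite sqr_sqrtr// mulr_ge0// subr_ge0.
have c2 : c0 ^+ 2 = (1 - xi - rho ^+ 2) * P2.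
  by rewrite exprMn !sqr_sqrtr// subr_ge0.
pose b0 := Num.sqrt t1; have b2 : b0 ^+ 2 = t1 by rewrite sqr_sqrtr// ltW.
(* Sending [r0] S costs power rho^2 P2 and, as [rho] is nonpositive, cancels part of the state: (1 +
   r0) S has variance [q]. With [c0 ^+ 2] and [g] it uses up exactly [P2]. *)
pose r0 := rho * Num.sqrt P2 / Num.sqrt Q.
have sQ0 : Num.sqrt Q != 0 by rewrite gt_eqF// sqrtr_gt0.
have rr2 : r0 ^+ 2 * Q = rho ^+ 2 * P2.
  rewrite -[in LHS](sqr_sqrtr (ltW Q0)) -exprMn /r0 divfK//.
  by rewrite exprMn sqr_sqrtr.
have qE : q = (1 + r0) ^+ 2 * Q.
  rewrite /q /Qt -[in RHS](sqr_sqrtr (ltW Q0)) -exprMn; congr (_ ^+ 2).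
  by rewrite /r0 mulrDl mul1r divfK.
set X1 := expR (2 * R1); set X3 := expR (2 * (Rc + R1)).
have {}r1 : X1 * D2 < D2 + t1 * D1.
  have B0 : 0 < 1 + t1 / (D2 / D1) by rewrite addr_gt0 ?divr_gt0.
  have := @lt_half_ln _ R1 1 _ ltr01 B0; rewrite ln1 mul0r addr0 r1 mulr1 => /esym.
  rewrite -/X1 -(ltr_pM2r D20) => /lt_le_trans; apply.
  by rewrite le_eqVlt; apply/orP; left; apply/eqP; field; rewrite !gt_eqF.
have {}r2 : X1 * D2 < g * (g + q + N + t1).
  have B0 : 0 < g * (g + q + N + t1) / D2 by rewrite divr_gt0// mulr_gt0// addr_gt0.
  have := @lt_half_ln _ R1 1 _ ltr01 B0; rewrite ln1 mul0r addr0 r2 mulr1 => /esym.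
  by rewrite ltr_pdivlMr.
(* The factor [g + q + N] is common to the denominator of [A3] and the numerator of [A4] and cancels
   in their product. *)
have {}r3 : X3 * D2 < g * (g + q + N + t1 + (a0 + c0) ^+ 2).
  move: r3; set A3 := 1 + _ / _; set A4 := _ / D2 => r3.
  have A30 : 0 < A3.
    rewrite addr_gt0// divr_gt0// ltr_wpDl ?sqr_ge0//.
  have A40 : 0 < A4 by rewrite divr_gt0// mulr_gt0.
  have : Rc + R1 + ln 1 / 2 < ln (A3 * A4) / 2.
    by rewrite ln1 mul0r addr0 lnM ?posrE// mulrDl.
  rewrite (lt_half_ln _ ltr01 (mulr_gt0 A30 A40)) mulr1 -/X3 -(ltr_pM2r D20) => /lt_le_trans; apply.
  rewrite le_eqVlt; apply/orP; left; apply/eqP; rewrite /A3 /A4 -/t1.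
  by field; rewrite !gt_eqF.
(* The indeterminate scales every amplitude, including [r0], while [al] stays fixed. At 1 these
   polynomials take the values 1 + r0, [q], [g], [D1], [D2], [t1] and (a0 + c0)^2. *)
pose pk : {poly R} := 1 + r0%:P * 'X.
pose pq : {poly R} := pk ^+ 2 * Q%:P.
pose pg : {poly R} := g%:P * 'X ^+ 2.
pose pD1 : {poly R} := pg + (al ^+ 2)%:P * pq.
pose pD2 : {poly R} := pg * pq * ((1 - al) ^+ 2)%:P + N%:P * pD1.
pose pb : {poly R} := t1%:P * 'X ^+ 2.
pose pc : {poly R} := ((a0 + c0) ^+ 2)%:P * 'X ^+ 2.
have hq x : pq.[x] = (1 + r0 * x) ^+ 2 * Q by rewrite !hornerE.
have hg x : pg.[x] = g * x ^+ 2 by rewrite !hornerE.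
have hD1 x : pD1.[x] = g * x ^+ 2 + al ^+ 2 * ((1 + r0 * x) ^+ 2 * Q).
  by rewrite !hornerE.
have hD2 x : pD2.[x] = g * x ^+ 2 * ((1 + r0 * x) ^+ 2 * Q) * (1 - al) ^+ 2 +
    N * (g * x ^+ 2 + al ^+ 2 * ((1 + r0 * x) ^+ 2 * Q)).
  by rewrite !hornerE.
have hb x : pb.[x] = t1 * x ^+ 2 by rewrite !hornerE.
have hc x : pc.[x] = (a0 + c0) ^+ 2 * x ^+ 2 by rewrite !hornerE.
clearbody pD2 pD1 pq pg pb pc pk.
have [|||t /andP[t0 tlt1] [f1 f2 f3]] := @exists_shrink R
  (pD2 + pb * pD1 - X1%:P * pD2) (pg * (pg + pq + N%:P + pb) - X1%:P * pD2)
  (pg * (pg + pq + N%:P + pb + pc) - X3%:P * pD2).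
- rewrite !hornerE hD1 hD2 hb !expr1n !mulr1 -qE -/D1 -/D2; lra.
- rewrite !hornerE hD2 hb hg hq !expr1n !mulr1 -qE -/D1 -/D2; lra.
- rewrite !hornerE hD2 hb hg hq hc !expr1n !mulr1 -qE -/D1 -/D2; lra.
pose G := g * t ^+ 2; pose k := 1 + r0 * t; pose q' := k ^+ 2 * Q.
pose D1' := G + al ^+ 2 * q'.
pose D2' := G * q' * (1 - al) ^+ 2 + N * D1'.
have G0 : 0 < G by rewrite mulr_gt0// exprn_gt0.
have q'0 : 0 <= q' by rewrite mulr_ge0 ?sqr_ge0// ltW.
have D1'0 : 0 < D1' by rewrite ltr_wpDr// mulr_ge0// sqr_ge0.
have D2'0 : 0 < D2'.
  apply: ltr_wpDl; last exact: mulr_gt0.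
  exact: mulr_ge0 (mulr_ge0 (ltW G0) q'0) (sqr_ge0 _).
have sg2 : (t * Num.sqrt g) ^+ 2 = G by rewrite exprMn sqr_sqrtr ?ltW// mulrC.
have su2 : Num.sqrt D1' ^+ 2 = D1' by rewrite sqr_sqrtr// ltW.
have tb2 : (t * b0) ^+ 2 = t1 * t ^+ 2 by rewrite exprMn b2 mulrC.
have [eE e2E] := @mmse_identities R G q' al N k Q erefl (lt0r_neq0 D1'0).
set be := (G + al * q') / D1' in eE e2E; set e := D2' / D1' in eE e2E.
have e0 : 0 < e by rewrite divr_gt0.
have t2 : t ^+ 2 < 1 by rewrite expr_lt1// ltW.
have {}f1 : X1 * D2' < D2' + (t * b0) ^+ 2 * D1'.
  by move: f1; rewrite !hornerE hD1 hD2 hb tb2 -/k -/q' -/G -/D1' -/D2' subr_gt0.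
have {}f2 : X1 * D2' < G * (G + q' + N + (t * b0) ^+ 2).
  by move: f2; rewrite !hornerE hD2 hb hg hq tb2 -/k -/q' -/G -/D1' -/D2' subr_gt0.
have tac : (t * a0 + t * c0) ^+ 2 = (a0 + c0) ^+ 2 * t ^+ 2.
  by rewrite -mulrDr exprMn mulrC.
have {}f3 : X3 * D2' < G * (G + q' + N + (t * b0) ^+ 2 + (t * a0 + t * c0) ^+ 2).
  rewrite tb2 tac; move: f3.
  rewrite !(hornerD, hornerN, hornerM, hornerC) hD2 hb hg hq hc -/k -/q' -/G -/D1' -/D2'.
  by rewrite subr_gt0.
have tb0 : 0 < (t * b0) ^+ 2 by rewrite tb2 mulr_gt0// exprn_gt0.
have bq0 : 0 <= be ^+ 2 * D1' by rewrite mulr_ge0 ?sqr_ge0// ltW.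
apply: (@achievable_of_params R d T P S Z Q N P1 P2 (t * a0) (t * b0) (t * c0)
  (r0 * t) al be e (Num.sqrt D1') (t * Num.sqrt g)) => //;
  rewrite ?sg2 ?su2 -?/k //.
- by rewrite sqrtr_gt0.
- by rewrite mulr_gt0// sqrtr_gt0.
- by apply: contra_ltN tb0 => /eqP ->; rewrite expr0n.
- by rewrite /D1' /q' addrC exprMn mulrA.
- rewrite tb2 exprMn a2 /t1.
  rewrite (_ : t ^+ 2 * ((1 - th) * P1) + th * P1 * t ^+ 2 = t ^+ 2 * P1); last by ring.
  by rewrite gtr_pMl.
- rewrite (_ : _ + G = t ^+ 2 * (c0 ^+ 2 + r0 ^+ 2 * Q + g)); last first.
    by rewrite /G; clearbody c0 g; ring.
  rewrite c2 rr2 (_ : _ + g = P2); last by rewrite /g; ring.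
  by rewrite gtr_pMl.
- have B0 : 0 < 1 + (t * b0) ^+ 2 / e by rewrite addr_gt0// divr_gt0.
  have := @lt_half_ln _ R1 1 _ ltr01 B0; rewrite ln1 mul0r addr0 mulr1 => ->.
  rewrite -/X1 -(ltr_pM2r D2'0); apply: (lt_le_trans f1).
  by rewrite le_eqVlt; apply/orP; left; apply/eqP; rewrite /e; field; rewrite !gt_eqF.
- rewrite lt_half_ln ?divr_gt0//; last first.
    by rewrite addr_gt0// divr_gt0// ltr_pwDl.
  rewrite (_ : 1 + _ / e = (G + q' + N + (t * b0) ^+ 2) / e); last first.
    have -> : G + q' + N = e + be ^+ 2 * D1' by rewrite e2E -/q' (addrC G).
    by field; rewrite gt_eqF.
  rewrite -/X1 -(ltr_pM2r (mulr_gt0 G0 e0)).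
  rewrite (_ : X1 * (D1' / G) * (G * e) = X1 * D2'); last first.
    by rewrite /e; field; rewrite !gt_eqF.
  apply: (lt_le_trans f2).
  by rewrite le_eqVlt; apply/orP; left; apply/eqP; field; rewrite !gt_eqF.
- rewrite lt_half_ln ?divr_gt0//; last first.
    by rewrite addr_gt0// divr_gt0// !ltr_pwDl ?sqr_ge0.
  rewrite (_ : 1 + _ / e = (G + q' + N + (t * b0) ^+ 2 + (t * a0 + t * c0) ^+ 2) / e);
    last first.
    have -> : G + q' + N = e + be ^+ 2 * D1' by rewrite e2E -/q' (addrC G).
    by field; rewrite gt_eqF.
  rewrite -/X3 -(ltr_pM2r (mulr_gt0 G0 e0)).
  rewrite (_ : X3 * (D1' / G) * (G * e) = X3 * D2'); last first.
    by rewrite /e; field; rewrite !gt_eqF.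
  apply: (lt_le_trans f3).
  by rewrite le_eqVlt; apply/orP; left; apply/eqP; field; rewrite !gt_eqF.
Qed.
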